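(* Let $\Theta\subseteq\mathbb{R}^D$. Let $E\subseteq\Theta$ be open (in $\mathbb{R}^D$) and bounded. Fix $\theta_0\in E$ and let $\pi:\Theta\to\mathbb{R}$ be a probability density with respect to Lebesgue measure such that $\pi$ is continuous at $\theta_0$ and $\pi(\theta_0)>0$. Let $f_n:\Theta\to\mathbb{R}$, $n\in\mathbb{N}$, have continuous third derivatives on $E$. Suppose $f_n\to f$ pointwise for some $f:\Theta\to\mathbb{R}$, $f''(\theta_0)$ is positive definite, and $(f_n''')$ is uniformly bounded on $E$. Suppose that either of the following two conditions is satisfied: (1) $f(\theta)>f(\theta_0)$ for all $\theta\in K\setminus\{\theta_0\}$ and $\liminf_n\inf_{\theta\in\Theta\setminus K}f_n(\theta)>f(\theta_0)$ for some compact $K\subseteq E$ with $\theta_0$ in the interior of $K$; or (2) each $f_n$ is convex and $f'(\theta_0)=0$. Define $z_n=\int_\Theta\exp(-nf_n(\theta))\pi(\theta)\,d\theta$ and $\pi_n(\theta)=\exp(-nf_n(\theta))\pi(\theta)/z_n$ for $\theta\in\Theta$ (extended by $0$ outside $\Theta$), and let $H_0=f''(\theta_0)$. Then there is a sequence $\theta_n\to\theta_0$ such that $f_n'(\theta_n)=0$ for all $n$ sufficiently large, $f_n(\theta_n)\to f(\theta_0)$, and: (i) $\int_{B_\varepsilon(\theta_0)}\pi_n(\theta)\,d\theta\to1$ as $n\to\infty$ for all $\varepsilon>0$; (ii) as $n\to\infty$, $$z_n\sim\frac{\exp(-nf_n(\theta_n))\,\pi(\theta_0)}{|\det H_0|^{1/2}}\Big(\frac{2\pi}{n}\Big)^{D/2}$$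 (where in the factor $2\pi/n$ the symbol $\pi$ is the circle constant); (iii) letting $q_n$ be the density of $\sqrt n(\theta-\theta_n)$ when $\theta\sim\pi_n$, $$\int_{\mathbb{R}^D}\big|q_n(x)-\mathcal{N}(x\mid0,H_0^{-1})\big|\,dx\to0\quad\text{as }n\to\infty.$$ Further, condition (2) implies condition (1) under the assumptions of the theorem.
   Context: $|\cdot|$ is the Euclidean norm; $B_r(x_0)=\{x\in\mathbb{R}^D:|x-x_0|<r\}$. For a real function $f$ on a subset of $\mathbb{R}^D$, $f'$ is the gradient, $f''$ the Hessian, and $f'''(\theta)=\big(\frac{\partial^3f}{\partial\theta_i\partial\theta_j\partial\theta_k}(\theta)\big)_{i,j,k}\in\mathbb{R}^{D^3}$; tensors carry the norm $\|T\|=(\sum_{i,j,k}T_{ijk}^2)^{1/2}$. $(f_n''')$ is uniformly bounded on $E$ if $\{\|f_n'''(\theta)\|:\theta\in E,\ n\in\mathbb{N}\}$ is bounded. Convexity on a possibly non-convex domain: $h:\Theta\to\mathbb{R}$ is convex if for all $\theta,\theta'\in\Theta$ and all $t\in[0,1]$ such that $t\theta+(1-t)\theta'\in\Theta$, we have $h(t\theta+(1-t)\theta')\le t\,h(\theta)+(1-t)\,h(\theta')$. $a_n\sim b_n$ for positive sequences means $a_n/b_n\to1$. $\mathcal{N}(x\mid\mu,C)$ is the normal density with mean $\mu$ and covariance matrix $C$. The infimum over the empty set is $+\infty$. All functions and sets are assumed measurable. *)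

(* Defs.v *)
From HB Require Import structures.
From mathcomp Require Import all_boot all_order all_algebra.
From mathcomp Require Import all_classical all_reals all_analysis.

Set Implicit Arguments.
Unset Strict Implicit.
Unset Printing Implicit Defensive.

Import Order.TTheory GRing.Theory Num.Theory.
Import numFieldNormedType.Exports.

Local Open Scope classical_set_scope.
Local Open Scope ring_scope.

Definition measure_rV_display : measure_display -> measure_display.
Proof. exact. Qed.

(* The sigma-algebra generated by the coordinate projections; as R is second
   countable, this is the Borel sigma-algebra of R^n (see open_measurable_rV
   for the nontrivial inclusion). *)
Section measurable_rV.
Context {R : realType} {n : nat}.

Let coors : 'I_n -> 'rV[R]_n -> R := fun i x => x ord0 i.

Let rV_set0 : g_sigma_preimage coors set0.
Proof. exact: sigma_algebra0. Qed.

Let rV_setC A : g_sigma_preimage coors A -> g_sigma_preimage coors (~` A).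
Proof. exact: sigma_algebraC. Qed.

Let rV_bigcup (F : (set 'rV[R]_n)^nat) :
  (forall i, g_sigma_preimage coors (F i)) ->
  g_sigma_preimage coors (\bigcup_i (F i)).
Proof. exact: sigma_algebra_bigcup. Qed.

HB.instance Definition _ := @isMeasurable.Build
  (measure_rV_display default_measure_display)
  'rV[R]_n (g_sigma_preimage coors) rV_set0 rV_setC rV_bigcup.

End measurable_rV.

Section measurable_rV_theory.
Context {R : realType}.

Lemma measurable_coord n (i : 'I_n) :
  measurable_fun [set: 'rV[R]_n] (fun x => x ord0 i).
Proof.
move=> _ Y mY; rewrite setTI; apply: sub_sigma_algebra => /=.
rewrite -bigcup_seq/=; exists i => /=; first by rewrite mem_index_enum.
by exists Y => //; rewrite setTI.
Qed.

Lemma measurable_fun_rVP d (T : measurableType d) n (f : T -> 'rV[R]_n) :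
  measurable_fun [set: T] f <->
  forall i, measurable_fun [set: T] (fun x => f x ord0 i).
Proof.
split=> [mf i|mf].
  exact: (measurableT_comp (measurable_coord i) mf).
move=> _ Y mY; rewrite setTI.
pose G := [set A : set 'rV[R]_n | measurable (f @^-1` A)].
suff : measurable `<=` G by move=> /(_ Y mY).
apply: smallest_sub.
  split; rewrite /G/=.
  - by rewrite preimage_set0.
  - by move=> A mA; rewrite setTD preimage_setC; exact: measurableC.
  - by move=> F mF; rewrite preimage_bigcup; exact: bigcupT_measurable.
rewrite -bigcup_seq; apply: bigcup_sub => i _ A [B mB <-].
rewrite /G/= setTI -[X in measurable X]setTI; exact: mf.
Qed.

Lemma open_measurable_rV n (U : set 'rV[R]_n) : open U -> measurable U.
Proof.
move=> oU.
pose box (ab : 'rV[rat]_n * 'rV[rat]_n) : set 'rV[R]_n :=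
  [set x | forall i, x ord0 i \in `]ratr (ab.1 ord0 i), ratr (ab.2 ord0 i)[].
have mbox ab : measurable (box ab).
  rewrite (_ : box ab = \bigcap_(i : 'I_n) [set x : 'rV[R]_n |
    x ord0 i \in `]ratr (ab.1 ord0 i), ratr (ab.2 ord0 i)[]).
    apply: fin_bigcap_measurable => // i _.
    have := measurable_coord i measurableT (measurable_itv
      `]ratr (ab.1 ord0 i) : R, ratr (ab.2 ord0 i) : R[).
    by rewrite setTI.
  by rewrite predeqE => x; split => [h i _|h i]; [exact: h|exact: (h i)].
rewrite (_ : U = \bigcup_ab (if `[< box ab `<=` U >] then box ab else set0)).
  apply: countable_bigcupT_measurable => [|ab].
    exact: countableP.
  by case: ifPn.
rewrite predeqE => x; split => [Ux|[ab _]]; last first.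
  by case: ifPn => // /asboolP sub /sub.
have : nbhs x U by exact: open_nbhs_nbhs.
move=> /nbhs_ballP[e /= e0 xeU].
have qa i : {q : rat | ratr q \in `]x ord0 i - e, x ord0 i[}.
  by apply/cid/rat_in_itvoo; rewrite gtrBl.
have qb i : {q : rat | ratr q \in `]x ord0 i, x ord0 i + e[}.
  by apply/cid/rat_in_itvoo; rewrite ltrDl.
exists (\row_i projT1 (qa i), \row_i projT1 (qb i)) => //.
case: ifPn => [_ i|/asboolP].
  rewrite /= !mxE in_itv/=.
  have := projT2 (qa i); rewrite in_itv/= => /andP[_ ->].
  by have := projT2 (qb i); rewrite in_itv/= => /andP[-> _].
case=> y yb; apply: xeU; split=> // i j; rewrite (ord1 i) {i}.
have := yb j; rewrite /= !mxE in_itv/= => /andP[ay yb'].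
have := projT2 (qa j); rewrite in_itv/= => /andP[xa _].
have := projT2 (qb j); rewrite in_itv/= => /andP[_ bx].
rewrite /ball/= ltr_distlC (lt_trans xa ay)/=.
exact: lt_trans bx.
Qed.

End measurable_rV_theory.

Section lebesgue_rV.
Context {R : realType}.
Local Open Scope ereal_scope.

Definition rV_cons n (p : R * 'rV[R]_n) : 'rV[R]_n.+1 :=
  row_mx (const_mx p.1 : 'rV[R]_1) p.2.

Lemma rV_cons0 n (p : R * 'rV[R]_n) : rV_cons p ord0 ord0 = p.1.
Proof.
transitivity (rV_cons p ord0 (lshift n (ord0 : 'I_1))).
  by congr (rV_cons p ord0 _); exact: val_inj.
by apply: etrans (row_mxEl _ _ _ _) _; rewrite mxE.
Qed.

Lemma rV_consS n (p : R * 'rV[R]_n) i :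
  rV_cons p ord0 (lift ord0 i) = p.2 ord0 i.
Proof.
transitivity (rV_cons p ord0 (rshift 1 i)).
  by congr (rV_cons p ord0 _); exact: val_inj.
exact: row_mxEr.
Qed.

Lemma measurable_rV_cons n : measurable_fun setT (@rV_cons n).
Proof.
apply/measurable_fun_rVP => i; case: (unliftP ord0 i) => [j|] ->.
  under eq_fun do rewrite rV_consS.
  exact: (measurableT_comp (measurable_coord j) measurable_snd).
by under eq_fun do rewrite rV_cons0; exact: measurable_fst.
Qed.

Section step.
Variables (n : nat) (mu : {sigma_finite_measure set 'rV[R]_n -> \bar R}).

Definition lebesgue_rV_step : set 'rV[R]_n.+1 -> \bar R :=
  pushforward (lebesgue_measure \x mu) (@rV_cons n).

Let step0 : lebesgue_rV_step set0 = 0.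
Proof. by rewrite /lebesgue_rV_step /pushforward preimage_set0 measure0. Qed.

Let step_ge0 A : 0 <= lebesgue_rV_step A.
Proof. by rewrite /lebesgue_rV_step /pushforward; exact: measure_ge0. Qed.

Let mpre A : measurable A -> measurable (@rV_cons n @^-1` A).
Proof. by move=> mA; rewrite -[X in measurable X]setTI; exact: measurable_rV_cons. Qed.

Let step_sigma_additive : semi_sigma_additive lebesgue_rV_step.
Proof.
move=> F mF tF mUF; rewrite /lebesgue_rV_step /pushforward preimage_bigcup.
apply: measure_semi_sigma_additive.
- by move=> k; exact: mpre.
- apply/trivIsetP => /= i j _ _ ij; rewrite -preimage_setI.
  by move/trivIsetP : tF => /(_ _ _ _ _ ij) ->//; rewrite preimage_set0.
- by rewrite -preimage_bigcup; exact: mpre.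
Qed.

HB.instance Definition _ := isMeasure.Build _ _ _
  lebesgue_rV_step step0 step_ge0 step_sigma_additive.

Let step_sigma_finite : sigma_finite setT lebesgue_rV_step.
Proof.
have /sigma_finiteP[F [TF ndF Foo]] := sigma_finiteT (@lebesgue_measure R).
have /sigma_finiteP[G [TG ndG Goo]] := sigma_finiteT mu.
exists (fun k => [set x : 'rV[R]_n.+1 | F k (x ord0 ord0) /\
                   G k (\row_i x ord0 (lift ord0 i))]).
  rewrite predeqE => x; split=> // _.
  have [k _ Fk] : (\bigcup_k F k) (x ord0 ord0) by rewrite -TF.
  have [l _ Gl] : (\bigcup_k G k) (\row_i x ord0 (lift ord0 i)) by rewrite -TG.
  exists (maxn k l) => //; split.
    by move: Fk; exact/subsetPset/ndF/leq_maxl.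
  by move: Gl; exact/subsetPset/ndG/leq_maxr.
move=> k; have [mF Fk] := Foo k; have [mG Gk] := Goo k.
have tail_meas : measurable_fun setT
    (fun x : 'rV[R]_n.+1 => \row_i x ord0 (lift ord0 i)).
  apply/measurable_fun_rVP => i; under eq_fun do rewrite mxE.
  exact: measurable_coord.
split.
  apply: measurableI.
    by rewrite -[X in measurable X]setTI; exact: measurable_coord.
  by rewrite -[X in measurable X]setTI; exact: tail_meas.
rewrite /lebesgue_rV_step /pushforward.
rewrite (_ : _ @^-1` _ = F k `*` G k).
  by rewrite product_measure1E// lte_mul_pinfty// ge0_fin_numE.
rewrite predeqE => -[a v] /=; rewrite rV_cons0/=.
suff -> : \row_i rV_cons (a, v) ord0 (lift ord0 i) = v by [].
by apply/rowP => i; rewrite mxE rV_consS.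
Qed.

HB.instance Definition _ := Measure_isSigmaFinite.Build _ _ _
  lebesgue_rV_step step_sigma_finite.

End step.

(* Lebesgue measure on R^n as an n-fold product measure; R^0 is a point. *)
Fixpoint lebesgue_rV (n : nat) : {sigma_finite_measure set 'rV[R]_n -> \bar R} :=
  match n return {sigma_finite_measure set 'rV[R]_n -> \bar R} with
  | 0 => [the {sigma_finite_measure set 'rV[R]_0 -> \bar R}
            of \d_(0%R : 'rV[R]_0)]
  | m.+1 => [the {sigma_finite_measure set 'rV[R]_m.+1 -> \bar R}
               of lebesgue_rV_step (lebesgue_rV m)]
  end.

Lemma lebesgue_rV_box n (A : 'I_n -> set R) : (forall i, measurable (A i)) ->
  lebesgue_rV n [set x | forall i, A i (x ord0 i)] =
  \prod_(i < n) lebesgue_measure (A i).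
Proof.
elim: n A => [|n IH] A mA.
  rewrite big_ord0 /= diracE mem_set//.
  by move=> [].
have mB : measurable [set x : 'rV[R]_n | forall i, A (lift ord0 i) (x ord0 i)].
  rewrite (_ : mkset _ = \bigcap_(i : 'I_n)
    [set x : 'rV[R]_n | A (lift ord0 i) (x ord0 i)]).
    apply: fin_bigcap_measurable => // i _.
    by have := measurable_coord i measurableT (mA (lift ord0 i)); rewrite setTI.
  by rewrite predeqE => x; split => [h i _|h i]; [exact: h|exact: (h i)].
rewrite big_ord_recl -(IH (fun i => A (lift ord0 i)) (fun i => mA _)).
apply: etrans (product_measure1E lebesgue_measure (lebesgue_rV n) (mA ord0) mB).
rewrite /lebesgue_rV_step /pushforward; congr (product_measure1 _ _ _).
rewrite predeqE => -[a v] /=; split=> [h|[h0 h1] i].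
  split; first by have := h ord0; rewrite rV_cons0.
  by move=> i; have := h (lift ord0 i); rewrite rV_consS.
case: (unliftP ord0 i) => [j|] ->; first by rewrite rV_consS.
by rewrite rV_cons0.
Qed.

End lebesgue_rV.
Arguments lebesgue_rV {R} n.

Section euclidean.
Context {R : realType} {D : nat}.
Implicit Types (x : 'rV[R]_D) (f h : 'rV[R]_D -> R) (E : set 'rV[R]_D).

(* The library norm on 'rV[R]_D is the max norm (same topology, same bounded
   sets); balls below are Euclidean. *)
Definition enorm x : R := Num.sqrt (\sum_i x ord0 i ^+ 2).

Definition eball x (r : R) : set 'rV[R]_D := [set y | enorm (y - x) < r].

Definition partial (i : 'I_D) f : 'rV[R]_D -> R :=
  fun x => 'D_(delta_mx ord0 i) f x.

Definition gradient f x : 'rV[R]_D := \row_i partial i f x.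

Definition hessian f x : 'M[R]_D := \matrix_(i, j) partial i (partial j f) x.

Definition third_deriv f x (i j k : 'I_D) : R :=
  partial i (partial j (partial k f)) x.

Definition tensor_norm (T : 'I_D -> 'I_D -> 'I_D -> R) : R :=
  Num.sqrt (\sum_i \sum_j \sum_k T i j k ^+ 2).

(* Three times differentiable at each point of E (meant for open E), with
   continuous third-order partial derivatives, i.e. f is C^3 on E. *)
Definition C3_on E f : Prop :=
  forall x, E x ->
  [/\ differentiable f x,
      forall k, differentiable (partial k f) x,
      forall j k, differentiable (partial j (partial k f)) x &
      forall i j k, {for x, continuous (fun y => third_deriv f y i j k)}].

(* E is not required to be convex: only the points of the segment that lie in
   E are tested. *)
Definition convex_fun_on E h : Prop :=
  forall x y (t : R), E x -> E y -> 0 <= t <= 1 ->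
  E (t *: x + (1 - t) *: y) ->
  h (t *: x + (1 - t) *: y) <= t * h x + (1 - t) * h y.

Definition posdefmx (A : 'M[R]_D) : Prop :=
  A^T = A /\ forall x, x != 0 -> 0 < (x *m A *m x^T) ord0 ord0.

Definition mvnormal_pdf (m : 'rV[R]_D) (C : 'M[R]_D) x : R :=
  (Num.sqrt ((2 * pi) ^+ D * \det C))^-1 *
  expR (- (((x - m) *m invmx C *m (x - m)^T) ord0 ord0) / 2).

Local Open Scope ereal_scope.

Definition prob_density_on (Theta : set 'rV[R]_D) (p : 'rV[R]_D -> R) : Prop :=
  [/\ measurable_fun Theta p, forall x, Theta x -> (0 <= p x)%R &
      \int[lebesgue_rV D]_(x in Theta) (p x)%:E = 1].

Definition with_density (p : 'rV[R]_D -> R) : set 'rV[R]_D -> \bar R :=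
  fun A => \int[lebesgue_rV D]_(x in A) (p x)%:E.

Definition is_density (P : set 'rV[R]_D -> \bar R) (q : 'rV[R]_D -> R) : Prop :=
  [/\ measurable_fun setT q, forall x, (0 <= q x)%R &
      forall A, measurable A -> P A = with_density q A].

(* z_n is extended-real valued, as it may be infinite for finitely many n. *)
Definition normalizer (Theta : set 'rV[R]_D) (prior : 'rV[R]_D -> R)
    (f_ : nat -> 'rV[R]_D -> R) (n : nat) : \bar R :=
  \int[lebesgue_rV D]_(x in Theta) (expR (- (n%:R * f_ n x)) * prior x)%:E.

Definition posterior (Theta : set 'rV[R]_D) (prior : 'rV[R]_D -> R)
    (f_ : nat -> 'rV[R]_D -> R) (n : nat) (x : 'rV[R]_D) : R :=
  if x \in Theta then
    (expR (- (n%:R * f_ n x)) * prior x / fine (normalizer Theta prior f_ n))%R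
  else 0%R.

(* a_n ~ b_n, where the limit in \bar R forces a_n to be eventually finite *)
Definition asymp_equiv (a : nat -> \bar R) (b : nat -> R) : Prop :=
  a n * (b n)^-1%:E @[n --> \oo] --> 1.

End euclidean.

(* Main.v *)
(** Along segments, a uniform bound on the third derivatives together with pointwise
    convergence forces the first and second partial derivatives of [f_ n] to converge
    to those of [f], and gives Taylor expansions whose cubic remainder is uniform in
    [n]. Hence [gradient f theta0 = 0], and a minimizer [theta_ n] of [f_ n] on a small
    closed ball around [theta0] is eventually interior, tends to [theta0] and
    satisfies [c |y - theta_ n|^2 <= f_ n y - f_ n (theta_ n)] on that ball.
    Compactness of [K] bounds [f_ n] away from [f theta0] outside any ball. Under
    convexity, the value at [y] outside a small ball is compared with the value where
    the segment from [theta0] to [y] crosses its boundary, so condition (2) implies (1).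

    Put [g_n x = exp (- n (f_ n y - f_ n (theta_ n))) * prior y] at
    [y = theta_ n + x / sqrt n] (and 0 if [y] is outside [Theta]). It converges
    pointwise to [prior theta0 * exp (- x H0 x / 2)], is dominated by a Gaussian while
    [y] stays in the ball, and its integral over the rest is at most
    [sqrt n ^ D * exp (- n d)], so it converges in L1. The three conclusions follow by
    rescaling and normalizing; the Gaussian integral is computed by induction on the
    dimension, integrating out one coordinate and passing to the Schur complement. *)

Require Import Defs.
From HB Require Import structures.
From mathcomp Require Import all_boot all_order all_algebra.
From mathcomp Require Import all_classical all_reals all_analysis.
From mathcomp Require Import measurable_realfun ring lra.

Set Implicit Arguments.
Unset Strict Implicit.
Unset Printing Implicit Defensive.

Import Order.TTheory GRing.Theory Num.Theory.
Import numFieldNormedType.Exports.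

Local Open Scope classical_set_scope.
Local Open Scope ring_scope.

(** * Taylor expansions with a uniform remainder *)

Lemma continuous_sumr {T : topologicalType} {K : numFieldType}
    {V : normedModType K} (I : Type) (r : seq I) (f : I -> T -> V) :
  (forall i, continuous (f i)) -> continuous (fun x => \sum_(i <- r) f i x).
Proof.
move=> cf x; apply: cvg_big => [|i _]; first exact: add_continuous.
exact: cf.
Qed.

Lemma continuous_mulr {T : topologicalType} {K : numFieldType} (f g : T -> K) :
  continuous f -> continuous g -> continuous (fun x => f x * g x).
Proof. by move=> cf cg x; apply: cvgM; [exact: cf|exact: cg]. Qed.

(** * Max norm, Euclidean norm and quadratic forms on row vectors *)

Section rV_norm.
Context {R : realType} {D : nat}.
Implicit Types (x y v : 'rV[R]_D) (A B : 'M[R]_D).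

(** The square of [enorm]. The library norm is the max norm; [norm2_le_sumsq] and [sumsq_le_norm2]
    compare the two. *)
Definition sumsq x : R := \sum_i x ord0 i ^+ 2.

Definition qform A x : R := (x *m A *m x^T) ord0 ord0.

Lemma coord_le_norm x i : `|x ord0 i| <= `|x|.
Proof.
rewrite [leRHS]mx_normrE.
by apply: (le_bigmax _ (fun ij : 'I_1 * 'I_D => `|x ij.1 ij.2|) (ord0, i)).
Qed.

Lemma sumsq_ge0 x : 0 <= sumsq x.
Proof. by apply: sumr_ge0 => i _; exact: sqr_ge0. Qed.

Lemma norm2_le_sumsq x : `|x| ^+ 2 <= sumsq x.
Proof.
have [->|x0] := eqVneq x 0; first by rewrite normr0 expr0n sumsq_ge0.
have /mx_norm_neq0[[i j] /= xE] : mx_norm x != 0.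
  by rewrite -[mx_norm x]/(`|x|) normr_eq0.
rewrite -[X in X ^+ 2]/(mx_norm x) xE real_normK ?num_real// (ord1 i).
rewrite /sumsq (bigD1 j)//= lerDl.
by apply: sumr_ge0 => k _; exact: sqr_ge0.
Qed.

Lemma sumsq_le_norm2 x : sumsq x <= D%:R * `|x| ^+ 2.
Proof.
apply: (@le_trans _ _ (\sum_(i < D) `|x| ^+ 2)).
  apply: ler_sum => i _; rewrite -[leLHS]real_normK ?num_real//.
  by rewrite lerXn2r ?nnegrE// coord_le_norm.
by rewrite sumr_const card_ord mulr_natl.
Qed.

Lemma sumsqZ (a : R) x : sumsq (a *: x) = a ^+ 2 * sumsq x.
Proof.
by rewrite /sumsq mulr_sumr; apply: eq_bigr => i _; rewrite mxE exprMn.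
Qed.

Lemma qformE A x : qform A x = \sum_i \sum_j x ord0 i * x ord0 j * A i j.
Proof.
rewrite /qform mxE exchange_big /=; apply: eq_bigr => j _.
by rewrite mxE mulr_suml; apply: eq_bigr => i _; rewrite !mxE mulrAC.
Qed.

Lemma qformZ (a : R) A x : qform A (a *: x) = a ^+ 2 * qform A x.
Proof.
rewrite !qformE mulr_sumr; apply: eq_bigr => i _.
by rewrite mulr_sumr; apply: eq_bigr => j _; rewrite !mxE; ring.
Qed.

Lemma qform0 A : qform A 0 = 0.
Proof. by rewrite -(scale0r 0) qformZ expr0n/= mul0r. Qed.

(** The entrywise l1 norm: it bounds quadratic forms against the max norm, and entrywise convergence
    suffices to make it small. *)
Definition sumabs A : R := \sum_i \sum_j `|A i j|.

Lemma sumabs_ge0 A : 0 <= sumabs A.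
Proof. by apply: sumr_ge0 => i _; apply: sumr_ge0. Qed.

Lemma qform_bound A x : `|qform A x| <= sumabs A * `|x| ^+ 2.
Proof.
rewrite qformE mulr_suml (le_trans (ler_norm_sum _ _ _))//; apply: ler_sum => i _.
rewrite mulr_suml (le_trans (ler_norm_sum _ _ _))//; apply: ler_sum => j _.
by rewrite !normrM mulrC ler_wpM2l// expr2 ler_pM// coord_le_norm.
Qed.

Lemma qformB A B x : qform (A - B) x = qform A x - qform B x.
Proof.
by rewrite /qform mulmxBr mulmxBl mxE [in X in _ + X]mxE.
Qed.

Lemma continuous_coord i : continuous (fun x => x ord0 i).
Proof. by move=> x; exact: coord_continuous. Qed.

Lemma continuous_qform A : continuous (qform A).
Proof.
rewrite (_ : qform A = fun x => \sum_i \sum_j x ord0 i * x ord0 j * A i j);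
  last by apply/funext => x; rewrite qformE.
apply: continuous_sumr => i; apply: continuous_sumr => j.
apply: continuous_mulr; last by move=> x; exact: cst_continuous.
by apply: continuous_mulr; exact: continuous_coord.
Qed.

Lemma continuous_sumsq : continuous sumsq.
Proof.
apply: continuous_sumr => i.
by under eq_fun do rewrite expr2; apply: continuous_mulr; exact: continuous_coord.
Qed.

(** The form attains a positive minimum on the compact Euclidean unit sphere, and homogeneity of
    degree 2 carries the bound to all vectors. *)
Lemma posdefmx_lower A : posdefmx A ->
  exists2 lam : R, 0 < lam & forall x, lam * sumsq x <= qform A x.
Proof.
move=> [_ posA]; pose S := [set x : 'rV[R]_D | sumsq x = 1].
(* An empty sphere is possible only when 0 is the sole vector, that is in dimension 0; the extreme
   value theorem needs a point. *)
have [S0|/set0P[z Sz]] := eqVneq S set0.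
  exists 1 => // x; have [->|x0] := eqVneq x 0.
    by rewrite qform0 mul1r (le_trans (sumsq_le_norm2 0))// normr0 expr0n/= mulr0.
  have sx : 0 < sumsq x.
    by rewrite (lt_le_trans _ (norm2_le_sumsq x))// exprn_gt0// normr_gt0.
  have : S ((Num.sqrt (sumsq x))^-1 *: x).
    by rewrite /S/= sumsqZ exprVn sqr_sqrtr ?sumsq_ge0// mulVf ?gt_eqF.
  by rewrite S0.
have cS : compact S.
  apply: bounded_closed_compact.
    exists 1; split=> // M M1 x /= Sx; rewrite (le_trans _ (ltW M1))//.
    by rewrite -(@ler_pXn2r _ 2) ?nnegrE// (le_trans (norm2_le_sumsq x))// Sx expr1n.
  rewrite (_ : S = sumsq @^-1` [set 1])//.
  by apply: closed_comp => //; move=> x _; exact: continuous_sumsq.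
have [|c cS' cmin] := @EVT_min_rV _ _ (qform A) S (ex_intro _ z Sz) cS.
  by apply: continuous_subspaceT; exact: continuous_qform.
have Sc : S c by move: cS'; rewrite inE.
have c0 : c != 0.
  apply/eqP => c0; move: Sc; rewrite /S/= c0 /sumsq big1 => [/eqP|i _].
    by rewrite eq_sym oner_eq0.
  by rewrite mxE expr0n.
exists (qform A c); first exact: posA.
move=> x; have [->|x0] := eqVneq x 0.
  rewrite qform0 (_ : sumsq 0 = 0) ?mulr0//.
  by rewrite /sumsq big1// => i _; rewrite mxE expr0n.
have sx : 0 < sumsq x.
  by rewrite (lt_le_trans _ (norm2_le_sumsq x))// exprn_gt0// normr_gt0.
have := cmin ((Num.sqrt (sumsq x))^-1 *: x).
rewrite inE qformZ exprVn sqr_sqrtr ?sumsq_ge0// ler_pdivlMl// mulrC.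
by apply; rewrite /S/= sumsqZ exprVn sqr_sqrtr ?sumsq_ge0// mulVf ?gt_eqF.
Qed.

Lemma norm_scale_delta (h : R) (i : 'I_D) : `|h *: (delta_mx ord0 i : 'rV[R]_D)| <= `|h|.
Proof.
rewrite normrZ -[leRHS]mulr1 ler_wpM2l// [leLHS]mx_normrE.
by apply: bigmax_le => // -[j k] _ /=; rewrite mxE; case: (_ && _); rewrite ?normr1 ?normr0.
Qed.

Lemma sum_scale_delta (h : R) (i : 'I_D) (a : 'I_D -> R) :
  \sum_j (h *: (delta_mx ord0 i : 'rV[R]_D)) ord0 j * a j = h * a i.
Proof.
rewrite (bigD1 i)//= big1 ?addr0 => [|j ji]; first by rewrite !mxE !eqxx mulr1.
by rewrite !mxE eqxx (negbTE ji) mulr0 mul0r.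
Qed.

Lemma qform_scale_delta (h : R) (i : 'I_D) (A : 'M[R]_D) :
  qform A (h *: delta_mx ord0 i) = h ^+ 2 * A i i.
Proof.
rewrite qformE; under eq_bigr do under eq_bigr do rewrite -mulrA.
under eq_bigr do rewrite -mulr_sumr sum_scale_delta.
by rewrite sum_scale_delta expr2 mulrA.
Qed.

End rV_norm.

(** * Taylor bounds on the unit interval *)

Section taylor_line.
Context {R : realType}.
Implicit Types (g : R -> R) (M : R).

Lemma mvt_unit_bound g g1 M :
  (forall s : R, 0 <= s <= 1 -> is_derive s 1 g (g1 s)) ->
  (forall s : R, 0 <= s <= 1 -> `|g1 s| <= M) ->
  forall t : R, 0 <= t <= 1 -> `|g t - g 0| <= M.
Proof.
move=> dg g1M t /andP[t0 t1].
have [s|s|c cI ->] := @MVT_segment R g g1 0 t t0.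
- by rewrite in_itv/= => /andP[s0 st]; apply: dg; rewrite !ltW// (lt_le_trans st).
- move: s; apply: derivable_within_continuous => s; rewrite in_itv/= => /andP[s0 st].
  by have [] := dg s; rewrite ?s0 ?(le_trans st).
- move: cI; rewrite in_itv/= => /andP[c0 ct].
  rewrite subr0 normrM (ger0_norm t0) (le_trans (ler_piMr _ t1))//.
  by apply: g1M; rewrite c0 (le_trans ct).
Qed.

(** The function [g t - t * g1 0] has derivative [g1 t - g1 0], which the mean value bound controls;
    a second use of that bound concludes. The usual factor 1/2 is given up, since only the order of
    the remainder matters. *)
Lemma taylor2_unit g g1 g2 M :
  (forall s : R, 0 <= s <= 1 -> is_derive s 1 g (g1 s)) ->
  (forall s : R, 0 <= s <= 1 -> is_derive s 1 g1 (g2 s)) ->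
  (forall s : R, 0 <= s <= 1 -> `|g2 s| <= M) ->
  forall t : R, 0 <= t <= 1 -> `|g t - g 0 - t * g1 0| <= M.
Proof.
move=> dg dg1 g2M t tI.
have := @mvt_unit_bound (fun t => g t - t * g1 0) (fun t => g1 t - g1 0) M _ _ t tI.
rewrite mul0r subr0 addrAC; apply.
  move=> s sI; have := dg s sI => dgs.
  apply: is_derive_eq; by rewrite scaler0 add0r scaler1.
exact: mvt_unit_bound dg1 g2M.
Qed.

Lemma taylor3_unit g g1 g2 g3 M :
  (forall s : R, 0 <= s <= 1 -> is_derive s 1 g (g1 s)) ->
  (forall s : R, 0 <= s <= 1 -> is_derive s 1 g1 (g2 s)) ->
  (forall s : R, 0 <= s <= 1 -> is_derive s 1 g2 (g3 s)) ->
  (forall s : R, 0 <= s <= 1 -> `|g3 s| <= M) ->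
  `|g 1 - g 0 - g1 0 - g2 0 / 2| <= M.
Proof.
move=> dg dg1 dg2 g3M.
have := @mvt_unit_bound (fun t => g t - t * g1 0 - t ^+ 2 * (g2 0 / 2))
  (fun t => g1 t - g1 0 - t * g2 0) M _ _ 1.
rewrite !mul0r !mul1r expr1n expr0n/= !mul0r !subr0 mul1r ler01 lexx => H.
rewrite (_ : _ - _ - _ - _ = g 1 - g1 0 - g2 0 / 2 - g 0); last by ring.
apply: H => //.
  move=> s sI; have := dg s sI => dgs.
  apply: is_derive_eq.
  by rewrite /GRing.scale/=; field.
exact: taylor2_unit dg1 dg2 g3M.
Qed.

End taylor_line.

(** * Taylor expansions along segments in several variables *)

Section taylor_rV.
Context {R : realType} {D : nat}.
Implicit Types (x v : 'rV[R]_D) (E : set 'rV[R]_D) (f : 'rV[R]_D -> R).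

Lemma hessianE f x i j : hessian f x i j = partial i (partial j f) x.
Proof. exact: mxE. Qed.

(** Differentiability makes the directional derivative linear in [v], so it expands in partial
    derivatives. Iterating this gives the higher derivatives along a segment. *)
Lemma is_derive_line f x v (t : R) : differentiable f (x + t *: v) ->
  is_derive t 1 (fun s : R => f (x + s *: v))
    (\sum_i v ord0 i * partial i f (x + t *: v)).
Proof.
move=> df; set y := x + t *: v.
have lineE : (fun h : R => h^-1 *: ((fun s => f (x + s *: v)) (h *: 1 + t) - f y)) =
             (fun h => h^-1 *: (f (h *: v + y) - f y)).
  by apply/funext => h; rewrite scaler1 scalerDl (addrCA x).
have partialE : \sum_i v ord0 i * partial i f y = 'D_v f y.
  rewrite deriveE// [in RHS](row_sum_delta v) linear_sum; apply: eq_bigr => i _.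
  by rewrite linearZ /partial deriveE.
split.
  by rewrite /derivable lineE; exact: diff_derivable.
by rewrite partialE /derive /= lineE.
Qed.

Lemma is_derive_lincomb n (c : 'I_n -> R) (h : 'I_n -> R -> R) (dh : 'I_n -> R)
    (t : R) : (forall i, is_derive t 1 (h i) (dh i)) ->
  is_derive t 1 (fun s => \sum_i c i * h i s) (\sum_i c i * dh i).
Proof.
move=> hd; rewrite (_ : (fun s => _) = \sum_i (c i \*: h i)); last first.
  by apply/funext => s; rewrite fct_sumE.
by apply: is_derive_sum => i; exact: is_deriveZ.
Qed.

Lemma tensor_coord_le (T : 'I_D -> 'I_D -> 'I_D -> R) i j k :
  `|T i j k| <= tensor_norm T.
Proof.
rewrite /tensor_norm -sqrtr_sqr ler_wsqrtr//.
rewrite (bigD1 i)//= (bigD1 j)//= (bigD1 k)//= -!addrA lerDl.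
rewrite !addr_ge0// !sumr_ge0// => *; rewrite ?sqr_ge0//.
  by apply: sumr_ge0 => *; exact: sqr_ge0.
by apply: sumr_ge0 => *; apply: sumr_ge0 => *; exact: sqr_ge0.
Qed.

(** Each contraction of a derivative tensor with [v] costs a factor [D%:R * |v|]; this is the source
    of the powers of [D] in the remainders below. *)
Lemma lincomb_bound v (a : 'I_D -> R) (M : R) : (forall i, `|a i| <= M) ->
  `|\sum_i v ord0 i * a i| <= D%:R * `|v| * M.
Proof.
move=> aM; rewrite (le_trans (ler_norm_sum _ _ _))//.
rewrite (_ : D%:R * _ * M = \sum_(i < D) `|v| * M); last first.
  by rewrite sumr_const card_ord -mulrA mulr_natl.
apply: ler_sum => i _.
by rewrite normrM ler_pM// coord_le_norm.
Qed.

(** The set [E] may fail to be convex, so each expansion carries the requirement that its own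
    segment stays in [E]. *)
Definition segment_in E x v := forall t : R, 0 <= t <= 1 -> E (x + t *: v).

Variables (E : set 'rV[R]_D) (f : 'rV[R]_D -> R) (M : R).
Hypothesis f_C3 : C3_on E f.
Hypothesis f_M : forall x, E x -> tensor_norm (third_deriv f x) <= M.

Let third_M x i j k : E x -> `|partial i (partial j (partial k f)) x| <= M.
Proof. by move=> Ex; rewrite (le_trans _ (f_M Ex))// (tensor_coord_le (third_deriv f x)). Qed.

Lemma partial2_lipschitz x v i j : segment_in E x v ->
  `|partial i (partial j f) (x + v) - partial i (partial j f) x| <= D%:R * `|v| * M.
Proof.
move=> xvE.
have := @mvt_unit_bound R (fun t => partial i (partial j f) (x + t *: v)) _ _ _ _ 1.
rewrite scale1r scale0r addr0; apply; last by rewrite ler01 lexx.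
  by move=> s sI; apply: is_derive_line; have [] := f_C3 (xvE s sI).
by move=> s sI; apply: lincomb_bound => k; apply: third_M; exact: xvE.
Qed.

Lemma taylor_partial x v j : segment_in E x v ->
  `|partial j f (x + v) - partial j f x - \sum_i v ord0 i * hessian f x i j|
    <= D%:R ^+ 2 * M * `|v| ^+ 2.
Proof.
move=> xvE.
rewrite (_ : D%:R ^+ 2 * M * _ = D%:R * `|v| * (D%:R * `|v| * M)); last by ring.
under [X in _ - X]eq_bigr do rewrite hessianE.
have := @taylor2_unit R (fun t => partial j f (x + t *: v))
  (fun t => \sum_i v ord0 i * partial i (partial j f) (x + t *: v))
  (fun t => \sum_i v ord0 i * \sum_k v ord0 k * partial k (partial i (partial j f)) (x + t *: v))
  _ _ _ _ 1.
rewrite scale1r scale0r addr0 mul1r; apply; last by rewrite ler01 lexx.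
- by move=> s sI; apply: is_derive_line; have [] := f_C3 (xvE s sI).
- move=> s sI; apply: is_derive_lincomb => i.
  by apply: is_derive_line; have [] := f_C3 (xvE s sI).
- move=> s sI; apply: lincomb_bound => i; apply: lincomb_bound => k.
  by apply: third_M; exact: xvE.
Qed.

Lemma taylor_rV x v : segment_in E x v ->
  `|f (x + v) - f x - \sum_i v ord0 i * partial i f x - qform (hessian f x) v / 2|
    <= D%:R ^+ 3 * M * `|v| ^+ 3.
Proof.
move=> xvE.
have := @taylor3_unit R (fun t => f (x + t *: v))
  (fun t => \sum_i v ord0 i * partial i f (x + t *: v))
  (fun t => \sum_i v ord0 i * \sum_j v ord0 j * partial j (partial i f) (x + t *: v))
  (fun t => \sum_i v ord0 i * \sum_j v ord0 j *
     \sum_k v ord0 k * partial k (partial j (partial i f)) (x + t *: v))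
  (D%:R * `|v| * (D%:R * `|v| * (D%:R * `|v| * M))).
rewrite scale1r scale0r addr0.
rewrite (_ : D%:R ^+ 3 * M * _ = D%:R * `|v| * (D%:R * `|v| * (D%:R * `|v| * M))); last by ring.
rewrite (_ : qform _ _ = \sum_i v ord0 i * \sum_j v ord0 j * partial j (partial i f) x).
  apply.
  - by move=> s sI; apply: is_derive_line; have [] := f_C3 (xvE s sI).
  - move=> s sI; apply: is_derive_lincomb => i.
    by apply: is_derive_line; have [] := f_C3 (xvE s sI).
  - move=> s sI; apply: is_derive_lincomb => i; apply: is_derive_lincomb => j.
    by apply: is_derive_line; have [] := f_C3 (xvE s sI).
  - move=> s sI; do 3 (apply: lincomb_bound => ?).
    by apply: third_M; exact: xvE.
(* Differentiating along the line produces the mixed partials with indices in the opposite order to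
   [hessian]; exchanging the two sums matches them. *)
rewrite qformE exchange_big; apply: eq_bigr => i _; rewrite mulr_sumr.
by apply: eq_bigr => j _; rewrite hessianE mulrA (mulrC (v ord0 j)).
Qed.

End taylor_rV.

(** * Convergence of first and second partial derivatives *)

Section pointwise_limits.
Context {R : realType} {D : nat}.
Implicit Types (x v : 'rV[R]_D).

Lemma norm_le_pmul (h a e : R) : 0 < h -> `|h * a| <= h * e -> `|a| <= e.
Proof. by move=> h0; rewrite normrM gtr0_norm// ler_pM2l. Qed.

(** A Cauchy argument: the limit comes from completeness, so it need not be identified beforehand.
    This matters for derivatives, as the limit function is not yet known to have any. *)
Lemma cvgn_approx (u : nat -> R) :
  (forall e : R, 0 < e -> exists w : nat -> R, cvgn w /\ forall n, `|u n - w n| <= e) ->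
  cvgn u.
Proof.
move=> uw; apply: cauchy_cvg; apply: cauchy_exP => e e0.
have [w [cw uwe]] := uw _ (divr_gt0 e0 (@ltr0n R 3)).
exists (lim (w n @[n --> \oo])).
have /cvgrPdist_lt/(_ _ (divr_gt0 e0 (@ltr0n R 3))) := cw.
apply: filterS => n /= wn; rewrite -ball_normE/=.
rewrite (le_lt_trans (ler_distD (w n) _ _))//.
have := uwe n; rewrite (distrC (u n)) => uwn.
by rewrite (le_lt_trans (lerD (ltW wn) uwn))//; lra.
Qed.

Lemma cvgn_norm_le (u : nat -> R) (l c : R) : u n @[n --> \oo] --> l ->
  (forall n, `|u n| <= c) -> `|l| <= c.
Proof.
move=> ul uc; apply: (@ler_cvg_to _ \oo _ _ (fun n => `|u n|) (fun=> c)).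
- exact: cvg_norm.
- exact: cvg_cst.
- exact: nearW.
Qed.

Lemma small_segment_in (E : set 'rV[R]_D) x : open E -> E x ->
  exists2 r : R, 0 < r & forall v, `|v| < r -> segment_in E x v.
Proof.
move=> oE Ex; have /nbhs_ballP[r /= r0 rE] : nbhs x E by exact: open_nbhs_nbhs.
exists r => // v vr t /andP[t0 t1]; apply: rE; rewrite -ball_normE/=.
by rewrite opprD addNKr normrN normrZ ger0_norm// (le_lt_trans _ vr)// ler_piMl.
Qed.

(** The difference quotient differs from [b] by at most [C * |h|]. Existence of the derivative is
    part of the conclusion, which is how the limit function acquires its partial derivatives. *)
Lemma is_derive_quadratic (f : 'rV[R]_D -> R) x v (b C r : R) : 0 < r ->
  (forall h : R, `|h| < r -> `|f (x + h *: v) - f x - h * b| <= C * `|h| ^+ 2) ->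
  is_derive x v f b.
Proof.
move=> r0 fb.
(* The sign of [C] is forced by the hypothesis at [h = r / 2]. *)
have C0 : 0 <= C.
  have := fb (r / 2); rewrite gtr0_norm ?divr_gt0// ltr_pdivrMr// ltr_pMr// ltr1n.
  move=> /(_ isT)/(le_trans (normr_ge0 _)); rewrite pmulr_lge0//.
  by rewrite exprn_gt0// divr_gt0.
suff lim_b : h^-1 *: (f (h *: v + x) - f x) @[h --> (0:R)^'] --> b.
  by split; [apply/cvg_ex; exists b|exact: cvg_lim].
apply/cvgrPdist_le => e e0.
near=> h.
have h0 : h != 0 by near: h; exact: nbhs_dnbhs_neq.
have hr : `|h| < r.
  by near: h; apply: dnbhs0_lt.
have he : `|h| < e / (C + 1).
  by near: h; apply: dnbhs0_lt; rewrite divr_gt0// ltr_wpDl.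
rewrite (_ : b - _ = - (h^-1 * (f (x + h *: v) - f x - h * b))); last first.
  by rewrite (addrC x) /GRing.scale/=; field.
rewrite normrN normrM normfV ler_pdivrMl ?normr_gt0// (le_trans (fb _ hr))//.
rewrite expr2 mulrCA ler_wpM2l//.
rewrite (le_trans (ler_wpM2l C0 (ltW he)))// mulrCA ger_pMr// ler_pdivrMr; lra.
Unshelve. all: by end_near. Qed.

Variables (E : set 'rV[R]_D) (f_ : nat -> 'rV[R]_D -> R) (f : 'rV[R]_D -> R) (M : R).
Hypothesis oE : open E.
Hypothesis f_C3 : forall n, C3_on E (f_ n).
Hypothesis f_M : forall n x, E x -> tensor_norm (third_deriv (f_ n) x) <= M.
Hypothesis f_f : forall x, E x -> f_ n x @[n --> \oo] --> f x.

Let small (r e C : R) : 0 < r -> 0 < e ->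
  exists h : R, [/\ 0 < h, h < r, h <= 1 & C * h <= e].
Proof.
move=> r0 e0; exists (Num.min (r / 2) (Num.min 1 (e / (`|C| + 1)))).
set h := Num.min _ _.
have h0 : 0 < h by rewrite !lt_min ltr01 !divr_gt0// ltr_wpDl.
split => //.
- by rewrite gt_min ltr_pdivrMr// ltr_pMr// ltr1n.
- by rewrite !ge_min lexx orbT.
- rewrite (@le_trans _ _ ((`|C| + 1) * h))//.
    by rewrite ler_pM2r// (le_trans (ler_norm _))// lerDl.
  by rewrite -ler_pdivlMl ?ltr_wpDl// mulrC !ge_min lexx !orbT.
Qed.

(* The bound on the third derivatives makes the symmetric difference quotients of
   step h accurate to O(h ^ 2) uniformly in n, while for fixed h they converge. *)
Lemma is_cvg_partial x j : E x -> cvgn (fun n => partial j (f_ n) x).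
Proof.
move=> Ex; have [r r0 rE] := small_segment_in oE Ex.
apply: cvgn_approx => e e0.
have [h [h0 hr h1 Ch]] := small (D%:R ^+ 3 * M) r0 e0.
set v : 'rV[R]_D := h *: delta_mx ord0 j.
have vh : `|v| <= h by rewrite (le_trans (norm_scale_delta _ _))// gtr0_norm.
have vE : E (x + v) by have := rE _ (le_lt_trans vh hr) 1; rewrite scale1r; apply; rewrite ler01 lexx.
have vNE : E (x - v).
  by have := rE (- v) _ 1; rewrite normrN scale1r; apply; [exact: le_lt_trans hr|rewrite ler01 lexx].
exists (fun n => (2 * h)^-1 * (f_ n (x + v) - f_ n (x - v))); split.
  apply: is_cvgMr; apply: is_cvgB; apply/cvg_ex.
    by exists (f (x + v)); exact: f_f.
  by exists (f (x - v)); exact: f_f.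
move=> n.
have := taylor_rV (f_C3 n) (f_M n) (rE _ (le_lt_trans vh hr)).
have := taylor_rV (f_C3 n) (f_M n) (rE (- v) _).
rewrite normrN => /(_ (le_lt_trans vh hr)).
rewrite (_ : - v = (- h) *: delta_mx ord0 j) ?scaleNr//.
rewrite -scaleNr !sum_scale_delta !qform_scale_delta sqrrN.
rewrite scaleNr -/v => Tm Tp.
have M0 : 0 <= D%:R ^+ 3 * M.
  by rewrite mulr_ge0 ?exprn_ge0// (le_trans _ (f_M n Ex))// sqrtr_ge0.
have vh3 : D%:R ^+ 3 * M * `|v| ^+ 3 <= h * e.
  apply: (@le_trans _ _ (D%:R ^+ 3 * M * h ^+ 3)).
    by rewrite ler_wpM2l// lerXn2r ?nnegrE// ltW.
  rewrite exprS mulrCA ler_pM2l// (le_trans _ Ch)// ler_wpM2l//.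
  by rewrite ger_pMr.
apply: (norm_le_pmul h0).
(* Subtracting the expansions at [v] and [- v] cancels the value at [x] and the second-order
   terms. *)
move: (le_trans Tm vh3) (le_trans Tp vh3); rewrite !ler_norml => /andP[a1 a2] /andP[b1 b2].
rewrite (_ : h * (partial _ _ _ - _) = h * partial j (f_ n) x - (f_ n (x + v) - f_ n (x - v)) / 2); last by field; rewrite gt_eqF.
by apply/andP; split; lra.
Qed.

(** Forward difference quotients of the first partials converge for fixed [h] by [is_cvg_partial],
    and are accurate to order [h] uniformly in [n]. *)
Lemma is_cvg_partial2 x i j : E x -> cvgn (fun n => partial i (partial j (f_ n)) x).
Proof.
move=> Ex; have [r r0 rE] := small_segment_in oE Ex.
apply: cvgn_approx => e e0.
have [h [h0 hr h1 Ch]] := small (D%:R ^+ 2 * M) r0 e0.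
set v : 'rV[R]_D := h *: delta_mx ord0 i.
have vh : `|v| <= h by rewrite (le_trans (norm_scale_delta _ _))// gtr0_norm.
have vE : E (x + v) by have := rE _ (le_lt_trans vh hr) 1; rewrite scale1r; apply; rewrite ler01 lexx.
exists (fun n => h^-1 * (partial j (f_ n) (x + v) - partial j (f_ n) x)); split.
  by apply: is_cvgMr; apply: is_cvgB; exact: is_cvg_partial.
move=> n.
have := taylor_partial (f_C3 n) (f_M n) j (rE _ (le_lt_trans vh hr)).
rewrite sum_scale_delta hessianE => T.
have M0 : 0 <= D%:R ^+ 2 * M.
  by rewrite mulr_ge0 ?exprn_ge0// (le_trans _ (f_M n Ex))// sqrtr_ge0.
have vh2 : D%:R ^+ 2 * M * `|v| ^+ 2 <= h * e.
  apply: (@le_trans _ _ (D%:R ^+ 2 * M * h ^+ 2)).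
    by rewrite ler_wpM2l// lerXn2r ?nnegrE// ltW.
  by rewrite expr2 mulrA mulrC ler_pM2l.
apply: (norm_le_pmul h0); rewrite (le_trans _ vh2)//.
rewrite (le_trans _ T)// -normrN le_eqVlt; apply/orP; left; apply/eqP.
by congr (`|_|); field; rewrite gt_eqF.
Qed.

Let C3M0 x : E x -> 0 <= D%:R ^+ 3 * M.
Proof.
by move=> Ex; rewrite mulr_ge0 ?exprn_ge0// (le_trans _ (f_M 0 Ex))// sqrtr_ge0.
Qed.

(** All coefficients of the expansion of [f_ n] along a coordinate axis converge. The expansion
    passes to the limit, and its linear coefficient must then be the partial derivative of [f]. *)
Lemma cvg_partial x j : E x -> partial j (f_ n) x @[n --> \oo] --> partial j f x.
Proof.
move=> Ex; have [r r0 rE] := small_segment_in oE Ex.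
have /cvg_ex[/= b fb] := is_cvg_partial (j := j) Ex.
have /cvg_ex[/= a fa] := is_cvg_partial2 (i := j) (j := j) Ex.
suff df : is_derive x (delta_mx ord0 j) f b by rewrite /partial derive_val.
(* The constant collects the second-order term and the cubic remainder, one factor [|h|] of the
   latter being bounded by [r]. *)
apply: (@is_derive_quadratic _ _ _ _ (`|a| / 2 + D%:R ^+ 3 * M * r) r) => // h hr.
set v : 'rV[R]_D := h *: delta_mx ord0 j.
have vh : `|v| <= `|h| by exact: norm_scale_delta.
have vr := le_lt_trans vh hr.
have xvE : E (x + v) by have := rE _ vr 1; rewrite scale1r; apply; rewrite ler01 lexx.
have : `|f (x + v) - f x - h * b - h ^+ 2 * a / 2| <= D%:R ^+ 3 * M * `|v| ^+ 3.
  apply: (@cvgn_norm_le (fun n => f_ n (x + v) - f_ n x - h * partial j (f_ n) x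
      - h ^+ 2 * partial j (partial j (f_ n)) x / 2)).
    apply: cvgB; first apply: cvgB; first by apply: cvgB; exact: f_f.
      exact: cvgMr.
    by apply: cvgMl; exact: cvgMr.
  move=> n; have := taylor_rV (f_C3 n) (f_M n) (rE _ vr).
  by rewrite sum_scale_delta qform_scale_delta hessianE.
have v3 : D%:R ^+ 3 * M * `|v| ^+ 3 <= D%:R ^+ 3 * M * r * `|h| ^+ 2.
  rewrite -[leRHS]mulrA ler_wpM2l ?(C3M0 Ex)// exprS ler_pM//; first exact: ltW.
  by rewrite lerXn2r ?nnegrE.
move=> /le_trans/(_ v3) T.
rewrite -[X in `|X|](subrK (h ^+ 2 * a / 2)) (le_trans (ler_normD _ _))//.
rewrite mulrDl addrC lerD// -mulrA normrM normrX mulrC ler_wpM2r//.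
by rewrite normrM [`|2^-1|]ger0_norm.
Qed.

Lemma cvg_partial2 x i j : E x ->
  partial i (partial j (f_ n)) x @[n --> \oo] --> partial i (partial j f) x.
Proof.
move=> Ex; have [r r0 rE] := small_segment_in oE Ex.
have /cvg_ex[/= a fa] := is_cvg_partial2 (i := i) (j := j) Ex.
suff df : is_derive x (delta_mx ord0 i) (partial j f) a.
  by rewrite [X in _ --> X](_ : _ = a)//; exact: derive_val.
apply: (@is_derive_quadratic _ _ _ _ (D%:R ^+ 2 * M) r) => // h hr.
set v : 'rV[R]_D := h *: delta_mx ord0 i.
have vh : `|v| <= `|h| by exact: norm_scale_delta.
have vr := le_lt_trans vh hr.
have xvE : E (x + v) by have := rE _ vr 1; rewrite scale1r; apply; rewrite ler01 lexx.
apply: (@cvgn_norm_le (fun n => partial j (f_ n) (x + v) - partial j (f_ n) x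
   - h * partial i (partial j (f_ n)) x)).
  apply: cvgB; first by apply: cvgB; exact: cvg_partial.
  exact: cvgMr.
move=> n; have := taylor_partial (f_C3 n) (f_M n) j (rE _ vr).
rewrite sum_scale_delta hessianE => /le_trans; apply.
rewrite ler_wpM2l ?lerXn2r ?nnegrE//.
by rewrite mulr_ge0 ?exprn_ge0// (le_trans _ (f_M n Ex))// sqrtr_ge0.
Qed.

Lemma cvg_gradient_lin x v : E x ->
  \sum_i v ord0 i * partial i (f_ n) x @[n --> \oo] --> \sum_i v ord0 i * partial i f x.
Proof.
move=> Ex; apply: cvg_big => [|i _]; first exact: add_continuous.
by apply: cvgMr; exact: cvg_partial.
Qed.

Lemma cvg_hessian_qform x v : E x ->
  qform (hessian (f_ n) x) v @[n --> \oo] --> qform (hessian f x) v.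
Proof.
move=> Ex; under eq_fun do rewrite qformE; rewrite qformE.
apply: cvg_big => [|i _]; first exact: add_continuous.
apply: cvg_big => [|j _]; first exact: add_continuous.
by apply: cvgMr; under eq_fun do rewrite hessianE; rewrite hessianE; exact: cvg_partial2.
Qed.

(** Obtained by letting [n] tend to infinity in the expansions of [f_ n], since [f] itself is not
    known to be C^3. *)
Lemma taylor_rV_lim x v : E x -> segment_in E x v ->
  `|f (x + v) - f x - \sum_i v ord0 i * partial i f x - qform (hessian f x) v / 2|
    <= D%:R ^+ 3 * M * `|v| ^+ 3.
Proof.
move=> Ex xvE.
have xvE1 : E (x + v) by have := xvE 1; rewrite scale1r; apply; rewrite ler01 lexx.
apply: (@cvgn_norm_le (fun n => f_ n (x + v) - f_ n x
    - \sum_i v ord0 i * partial i (f_ n) x - qform (hessian (f_ n) x) v / 2)).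
  apply: cvgB; last by apply: cvgMl; exact: cvg_hessian_qform.
  apply: cvgB; last exact: cvg_gradient_lin.
  by apply: cvgB; exact: f_f.
by move=> n; exact: (taylor_rV (f_C3 n) (f_M n) xvE).
Qed.

End pointwise_limits.

(** * Minimizers of the approximating functions *)

Section local_minimum.
Context {R : realType} {D : nat}.
Implicit Types (x v : 'rV[R]_D).

Lemma cvg_sumabs_dist (A_ : nat -> 'M[R]_D) (A : 'M[R]_D) :
  (forall i j, A_ n i j @[n --> \oo] --> A i j) ->
  sumabs (A_ n - A) @[n --> \oo] --> (0:R).
Proof.
move=> AA; have -> : 0 = sumabs (A - A) :> R.
  by rewrite subrr /sumabs big1// => i _; rewrite big1// => j _; rewrite mxE normr0.
apply: cvg_big => [|i _]; first exact: add_continuous.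
apply: cvg_big => [|j _]; first exact: add_continuous.
apply: cvg_norm.
have subE (B : 'M[R]_D) : (B - A) i j = B i j - A i j by rewrite !mxE.
under eq_fun do rewrite subE; rewrite subE.
by apply: cvgB; [exact: AA|exact: cvg_cst].
Qed.

(** If some partial derivative [b] were nonzero, a step of length [t] against its sign would change
    the linear term by [- t * |b|], with an error of at most half that size. A quadratic estimate
    replaces differentiability, so the lemma serves both [f_ n] and the limit [f]. *)
Lemma local_min_gradient0 (f : 'rV[R]_D -> R) x (r C : R) : 0 < r ->
  (forall v, `|v| < r -> f x <= f (x + v)) ->
  (forall v, `|v| < r ->
    `|f (x + v) - f x - \sum_i v ord0 i * partial i f x| <= C * `|v| ^+ 2) ->
  gradient f x = 0.
Proof.
move=> r0 fmin fC; apply/rowP => i; rewrite /gradient [LHS]mxE [RHS]mxE.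
apply/eqP/negPn/negP => b0; set b := partial i f x in b0.
have C1 : 0 < `|C| + 1 by rewrite ltr_wpDl.
(* Besides staying within [r], [t] makes the quadratic error at most [t * |b| / 2]; the denominator
   [|C| + 1] is positive whatever the sign of [C]. *)
pose t := Num.min (r / 2) (`|b| / 2 / (`|C| + 1)).
have t0 : 0 < t by rewrite lt_min !divr_gt0// normr_gt0.
have tr : t < r by rewrite gt_min ltr_pdivrMr// ltr_pMr// ltr1n.
have tb : (`|C| + 1) * t <= `|b| / 2.
  by rewrite -ler_pdivlMl// mulrC ge_min lexx orbT.
pose h := - Num.sg b * t.
have hE : `|h| = t by rewrite normrM normrN normr_sg b0 mul1r gtr0_norm.
pose v : 'rV[R]_D := h *: delta_mx ord0 i.
have vh : `|v| <= t by rewrite -hE; exact: norm_scale_delta.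
have vr := le_lt_trans vh tr.
have := fC _ vr; rewrite sum_scale_delta -/b => /ler_normlP[_].
have := fmin _ vr.
have -> : h * b = - (t * `|b|) by rewrite /h mulrAC mulNr -normrEsg mulNr mulrC.
have Cv : C * `|v| ^+ 2 <= t * (`|b| / 2).
  apply: (@le_trans _ _ ((`|C| + 1) * t ^+ 2)).
    rewrite (@le_trans _ _ ((`|C| + 1) * `|v| ^+ 2))//.
      by rewrite ler_wpM2r// (le_trans (ler_norm _))// lerDl.
    by rewrite ler_pM2l// lerXn2r ?nnegrE// ltW.
  by rewrite expr2 mulrCA ler_pM2l.
have : 0 < t * `|b| by rewrite mulr_gt0// normr_gt0.
by lra.
Qed.

Lemma taylor_order1 (f : 'rV[R]_D -> R) x v (C r : R) : 0 <= C -> `|v| <= r ->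
  `|f (x + v) - f x - \sum_i v ord0 i * partial i f x - qform (hessian f x) v / 2|
    <= C * `|v| ^+ 3 ->
  `|f (x + v) - f x - \sum_i v ord0 i * partial i f x|
    <= (sumabs (hessian f x) / 2 + C * r) * `|v| ^+ 2.
Proof.
move=> C0 vr T; rewrite -[X in `|X|](subrK (qform (hessian f x) v / 2)).
rewrite (le_trans (ler_normD _ _))// mulrDl addrC lerD//.
  rewrite normrM [`|2^-1|]ger0_norm// mulrAC ler_wpM2r//; exact: qform_bound.
rewrite (le_trans T)// -mulrA ler_wpM2l// exprS ler_wpM2r//.
Qed.

End local_minimum.

(** * Lower bounds on [f_ n] that are uniform in [n] near a point *)

Section localization.
Context {R : realType} {D : nat}.
Implicit Types (x v : 'rV[R]_D).
Variables (E : set 'rV[R]_D) (f_ : nat -> 'rV[R]_D -> R) (f : 'rV[R]_D -> R) (M : R).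
Hypothesis oE : open E.
Hypothesis f_C3 : forall n, C3_on E (f_ n).
Hypothesis f_M : forall n x, E x -> tensor_norm (third_deriv (f_ n) x) <= M.
Hypothesis f_f : forall x, E x -> f_ n x @[n --> \oo] --> f x.

Let C := D%:R ^+ 3 * M.

Let C_ge0 x : E x -> 0 <= C.
Proof.
by move=> Ex; rewrite mulr_ge0 ?exprn_ge0// (le_trans _ (f_M 0 Ex))// sqrtr_ge0.
Qed.

Lemma cvg_sum_abs_partial x : E x ->
  \sum_i `|partial i (f_ n) x| @[n --> \oo] --> \sum_i `|partial i f x|.
Proof.
move=> Ex; apply: cvg_big => [|i _]; first exact: add_continuous.
apply: cvg_norm; exact: (cvg_partial oE f_C3 f_M f_f).
Qed.

Lemma cvg_hessian x i j : E x ->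
  hessian (f_ n) x i j @[n --> \oo] --> hessian f x i j.
Proof.
move=> Ex; under eq_fun do rewrite hessianE; rewrite hessianE.
exact: (cvg_partial2 oE f_C3 f_M f_f).
Qed.

Lemma cvg_hessian_sumabs x : E x ->
  sumabs (hessian (f_ n) x) @[n --> \oo] --> sumabs (hessian f x).
Proof.
move=> Ex; apply: cvg_big => [|i _]; first exact: add_continuous.
apply: cvg_big => [|j _]; first exact: add_continuous.
by apply: cvg_norm; exact: cvg_hessian.
Qed.

Lemma taylor_lower n x v : segment_in E x v ->
  f_ n x - \sum_i `|partial i (f_ n) x| * `|v| + qform (hessian (f_ n) x) v / 2
    - C * `|v| ^+ 3 <= f_ n (x + v).
Proof.
move=> xvE; have := taylor_rV (f_C3 n) (f_M n) xvE.
rewrite -/C => /ler_normlP[+ _].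
have : - \sum_i v ord0 i * partial i (f_ n) x <= \sum_i `|partial i (f_ n) x| * `|v|.
  rewrite (le_trans (ler_norm _))// normrN (le_trans (ler_norm_sum _ _ _))//.
  by apply: ler_sum => i _; rewrite normrM mulrC ler_wpM2l// coord_le_norm.
by lra.
Qed.

(** The value, gradient and Hessian of [f_ n] at [x] converge, so the expansion centred at [x]
    bounds [f_ n] from below on a ball whose radius does not depend on [n]. *)
Lemma locally_above x (a : R) : E x -> a < f x ->
  exists s d : R, [/\ 0 < s, 0 < d &
    \forall n \near \oo, forall y, `|y - x| < s -> a + d <= f_ n y].
Proof.
move=> Ex ax; have [r r0 rE] := small_segment_in oE Ex.
set G := \sum_i `|partial i f x| + 1; set B := sumabs (hessian f x) + 1.
(* A quarter of the gap: one [d] is spent on the convergence of [f_ n x] and one on the Taylor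
   terms, which leaves more than the [d] required. *)
set d := (f x - a) / 4.
have d0 : 0 < d by rewrite divr_gt0// subr_gt0.
have G0 : 0 < G by rewrite ltr_wpDl// sumr_ge0.
have B0 : 0 < B by rewrite ltr_wpDl// sumabs_ge0.
have C0 := C_ge0 Ex.
have S0 : 0 < G + B + C by rewrite ltr_wpDr// addr_gt0.
(* Radius at most 1 lets every power of the distance be replaced by its first power. *)
exists (Num.min r (Num.min 1 (d / (G + B + C)))), d; split => //.
  by rewrite !lt_min r0 ltr01 divr_gt0.
have fn : \forall n \near \oo, f x - d <= f_ n x.
  have /cvgrPdist_le/(_ _ d0) := f_f Ex.
  by apply: filterS => n /ler_normlP[_]; lra.
have gn : \forall n \near \oo, \sum_i `|partial i (f_ n) x| <= G.
  by apply: (cvgr_le _ (cvg_sum_abs_partial Ex)); rewrite ltrDl.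
have bn : \forall n \near \oo, sumabs (hessian (f_ n) x) <= B.
  by apply: (cvgr_le _ (cvg_hessian_sumabs Ex)); rewrite ltrDl.
near=> n => y; rewrite !lt_min => /and3P[yr y1 yd].
have := taylor_lower n (rE _ yr); rewrite subrKC.
set t := `|y - x| in yr y1 yd *.
have t0 : 0 <= t by exact: normr_ge0.
have : \sum_i `|partial i (f_ n) x| * t <= G * t.
  by rewrite -mulr_suml ler_wpM2r//; near: n.
have : - (qform (hessian (f_ n) x) (y - x) / 2) <= B * t.
  have := qform_bound (hessian (f_ n) x) (y - x) => /ler_normlP[+ _].
  have : sumabs (hessian (f_ n) x) * t ^+ 2 <= B * t.
    apply: ler_pM; rewrite ?sumabs_ge0 ?sqr_ge0//; first by near: n.
    by rewrite expr2 ler_piMr// ltW.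
  rewrite -/t; have : 0 <= B * t by rewrite mulr_ge0// ltW.
  by lra.
have : C * t ^+ 3 <= C * t.
  by rewrite ler_wpM2l// exprS ler_piMr// exprn_ile1// ltW.
have : (G + B + C) * t <= d by rewrite mulrC -ler_pdivlMr// ltW.
have : f x - d <= f_ n x by near: n.
have : 4 * d = f x - a by rewrite /d; field.
by lra.
Unshelve. all: by end_near. Qed.

Variable x0 : 'rV[R]_D.
Hypothesis Ex0 : E x0.
Hypothesis grad0 : gradient f x0 = 0.

(* Taylor expansion at the fixed point x0 makes the error eta uniform over the ball. *)
Lemma uniform_quadratic_lower (r lam : R) : 0 <= r ->
  (forall v, `|v| <= r -> segment_in E x0 v) ->
  (forall v, lam * sumsq v <= qform (hessian f x0) v) ->
  C * r <= lam / 4 ->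
  exists2 eta : nat -> R, eta n @[n --> \oo] --> (0:R) &
    forall n v, `|v| <= r -> f x0 - eta n + lam / 4 * `|v| ^+ 2 <= f_ n (x0 + v).
Proof.
move=> r0 rE lamE Cr.
have lam0 : 0 <= lam by have := le_trans (mulr_ge0 (C_ge0 Ex0) r0) Cr; lra.
(* The three summands of [eta] are the errors in the value, the gradient and the Hessian at [x0],
   weighted by the powers of [r] that bound those of [|v|]. *)
exists (fun n => `|f x0 - f_ n x0| + r * \sum_i `|partial i (f_ n) x0|
   + r ^+ 2 * sumabs (hessian (f_ n) x0 - hessian f x0)).
  rewrite [X in _ --> X](_ : 0 = 0 + r * 0 + r ^+ 2 * 0 :> R); last by ring.
  apply: cvgD; first apply: cvgD.
  - rewrite -[X in _ --> X](@normr0 _ R); apply: cvg_norm.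
    rewrite -[X in _ --> X](subrr (f x0)); apply: cvgB; first exact: cvg_cst.
    exact: f_f.
  - apply: cvgMr; rewrite [X in _ --> X](_ : 0 = \sum_i `|partial i f x0|).
      exact: cvg_sum_abs_partial.
    rewrite big1// => i _; move/rowP : grad0 => /(_ i).
    by rewrite /gradient [LHS]mxE [RHS]mxE => ->; rewrite normr0.
  - apply: cvgMr; apply: cvg_sumabs_dist => i j.
    exact: cvg_hessian.
move=> n v vr.
(* Half of the limiting form gives at least [lam / 2 * w]; the cubic term [K] uses up at most
   [lam / 4 * w]. *)
have arith (a b d p g S G Q Q0 K w y : R) : a - b <= d -> S <= p -> G <= g -> 0 <= g ->
    lam * w <= Q0 -> - (Q - Q0) <= G -> K <= lam / 4 * w ->
    b - S + Q / 2 - K <= y -> a - (d + p + g) + lam / 4 * w <= y.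
  by move=> *; lra.
have lamv : lam * `|v| ^+ 2 <= qform (hessian f x0) v.
  by rewrite (le_trans _ (lamE v))// ler_wpM2l// norm2_le_sumsq.
apply: arith (taylor_lower n (rE _ vr)).
- exact: ler_norm.
- by rewrite -mulr_suml mulrC ler_wpM2r// sumr_ge0.
- apply: (@le_trans _ _ (sumabs (hessian (f_ n) x0 - hessian f x0) * `|v| ^+ 2)).
    exact: lexx.
  by rewrite mulrC ler_wpM2r ?sumabs_ge0// lerXn2r ?nnegrE.
- by rewrite mulr_ge0 ?sqr_ge0 ?sumabs_ge0.
- exact: lamv.
- by have := qform_bound (hessian (f_ n) x0 - hessian f x0) v; rewrite qformB => /ler_normlP[].
- rewrite exprS mulrA ler_wpM2r ?sqr_ge0// (le_trans _ Cr)// ler_wpM2l//.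
  exact: C_ge0 Ex0.
Qed.

End localization.

Lemma continuous_dist {K : numFieldType} {V : normedModType K} (x : V) :
  continuous (fun y : V => `|y - x|).
Proof. by move=> y; apply: cvg_norm; apply: cvgB; [exact: cvg_id|exact: cvg_cst]. Qed.

(** Half of [Q0] is at least [lam / 2 * s]; the perturbation of the form and the cubic term cost
    [lam / 8 * s] each. *)
Lemma quadratic_lower_arith {R : realFieldType} (lam Q Q0 s u c : R) :
  lam * s <= Q0 -> - (u - Q / 2) <= c -> c <= lam / 8 * s ->
  - (Q - Q0) <= lam / 4 * s -> lam / 4 * s <= u.
Proof. by move=> *; lra. Qed.

(** * Minimizers, the gap away from the limit point, and the convex case *)

Section tails.
Context {R : realType} {D : nat}.
Implicit Types (x v : 'rV[R]_D).

(** A closed ball for the max norm, in contrast to the Euclidean [eball]. *)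
Definition cball x (r : R) : set 'rV[R]_D := [set y | `|y - x| <= r].

Lemma cball_compact x r : compact (cball x r).
Proof.
apply: bounded_closed_compact.
  exists (r + `|x|); split => [|N rN y /= yr]; first exact: num_real.
  by rewrite -(subrK x y) (le_trans (ler_normD _ _))// (le_trans _ (ltW rN))// lerD2r.
rewrite (_ : cball x r = (fun y => `|y - x|) @^-1` [set z | z <= r])//.
apply: closed_comp; last exact: closed_le.
by move=> y _; exact: continuous_dist.
Qed.

Lemma cball_segment_in (E : set 'rV[R]_D) x r y z :
  cball x r `<=` E -> cball x r y -> cball x r z -> segment_in E y (z - y).
Proof.
move=> rE yr zr t /andP[t0 t1]; apply: rE.
rewrite /cball/= (_ : _ - x = (1 - t) *: (y - x) + t *: (z - x)); last first.
  by apply/rowP => i; rewrite !mxE; ring.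
rewrite (le_trans (ler_normD _ _))// !normrZ !ger0_norm ?subr_ge0//.
rewrite (_ : r = (1 - t) * r + t * r); last by ring.
by rewrite lerD// ler_wpM2l// subr_ge0.
Qed.

Lemma cball_segment_in_shift (E : set 'rV[R]_D) x r y v :
  cball x r `<=` E -> cball x r y -> cball x r (y + v) -> segment_in E y v.
Proof. by move=> rE yr /(cball_segment_in rE yr); rewrite addrAC subrr add0r. Qed.

Lemma cball_center x r v : `|v| <= r -> cball x r (x + v).
Proof. by rewrite /cball/= addrAC subrr add0r. Qed.

Lemma cball_half x r y v : cball x (r / 2) y -> `|v| <= r / 2 -> cball x r (y + v).
Proof.
rewrite /cball/= addrAC => yr vr; rewrite (le_trans (ler_normD _ _))//.
by rewrite [leRHS](splitr r) lerD.
Qed.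

Lemma cvg0_norm_le (u b : nat -> R) : (\forall n \near \oo, `|u n| <= b n) ->
  b n @[n --> \oo] --> (0:R) -> u n @[n --> \oo] --> (0:R).
Proof.
move=> ub b0; apply: (@squeeze_cvgr _ _ _ _ (fun n => - b n) b) => //.
  by apply: filterS ub => n; rewrite ler_norml.
by rewrite -oppr0; exact: cvgN.
Qed.

Lemma cvg_sqrtn_inv : (Num.sqrt (n%:R : R))^-1 @[n --> \oo] --> (0:R).
Proof.
apply/cvgrPdist_le => e e0; near=> n.
have n0 : (0 < n%:R :> R) by near: n; exact: nbhs_infty_gtr.
rewrite sub0r normrN ger0_norm ?invr_ge0 ?sqrtr_ge0//.
rewrite -[leRHS]invrK lef_pV2 ?posrE ?invr_gt0 ?sqrtr_gt0//.
rewrite -[leLHS]ger0_norm ?invr_ge0 ?(ltW e0)// -sqrtr_sqr ler_sqrt ?ltW//.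
by near: n; exact: nbhs_infty_gtr.
Unshelve. all: by end_near. Qed.

Lemma limn_einf_gt_near (u : nat -> \bar R) (a : R) : (a%:E < limn_einf u)%E ->
  exists2 d : R, 0 < d & \forall n \near \oo, ((a + d)%:E <= u n)%E.
Proof.
rewrite limn_einf_lim (cvg_lim _ (@cvg_einfs_sup _ u))//.
move=> /ereal_sup_gt[_ [N _ <-]] aN.
have [d d0 dN] : exists2 d : R, 0 < d & ((a + d)%:E <= einfs u N)%E.
  case: (einfs u N) aN => [b| |//].
    by rewrite lte_fin => ab; exists (b - a); rewrite ?subr_gt0// subrKC.
  (* An infinite infimum, as when [Theta] minus [K] is empty, admits any gap. *)
  by move=> _; exists 1 => //; rewrite leey.
exists d => //; exists N => // n /= Nn; rewrite (le_trans dN)//.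
by apply: ereal_inf_lbound; exists n.
Qed.

Lemma near_limn_einf_ge (u : nat -> \bar R) (a : \bar R) :
  (\forall n \near \oo, (a <= u n)%E) -> (a <= limn_einf u)%E.
Proof.
move=> [N _ aN]; rewrite limn_einf_lim (cvg_lim _ (@cvg_einfs_sup _ u))//.
apply: (@le_trans _ _ (einfs u N)); last by apply: ereal_sup_ubound; exists N.
by apply: le_ereal_inf_tmp => _ [n /= Nn <-]; exact: aN.
Qed.

Variables (Theta E : set 'rV[R]_D) (f_ : nat -> 'rV[R]_D -> R) (f : 'rV[R]_D -> R) (M : R).
Hypothesis E_Theta : E `<=` Theta.
Hypothesis oE : open E.
Hypothesis f_C3 : forall n, C3_on E (f_ n).
Hypothesis f_M : forall n x, E x -> tensor_norm (third_deriv (f_ n) x) <= M.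
Hypothesis f_f : forall x, E x -> f_ n x @[n --> \oo] --> f x.
Variable x0 : 'rV[R]_D.
Hypothesis Ex0 : E x0.

Let C := D%:R ^+ 3 * M.

Let C_ge0 x : E x -> 0 <= C.
Proof.
by move=> Ex; rewrite mulr_ge0 ?exprn_ge0// (le_trans _ (f_M 0 Ex))// sqrtr_ge0.
Qed.

(** On the compact part of [K] away from [x0], [locally_above] supplies a gap and a rank at each
    point. The near-covering form of compactness, taken over pairs [(n, d)], makes both uniform at
    once. *)
Lemma uniformly_above_on_compact (K : set 'rV[R]_D) (eps : R) : compact K -> K `<=` E ->
  (forall y, K y -> y != x0 -> f x0 < f y) -> 0 < eps ->
  exists2 d : R, 0 < d & \forall n \near \oo, forall y, K y -> eps <= `|y - x0| ->
    f x0 + d <= f_ n y.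
Proof.
move=> cK KE fK e0; pose K' := K `&` [set y | eps <= `|y - x0|].
have cK' : compact K'.
  apply: compact_closedI => //.
  rewrite (_ : mkset _ = (fun y => `|y - x0|) @^-1` [set z | eps <= z])//.
  apply: closed_comp; last exact: closed_ge.
  by move=> y _; exact: continuous_dist.
have nearK' x : K' x -> \forall y \near x & nd \near filter_prod \oo (0:R)^'+,
    f x0 + nd.2 <= f_ nd.1 y.
  move=> [Kx xe]; have : x != x0.
    by apply: contraTneq xe => ->; rewrite subrr normr0 -ltNge.
  move=> /(fK _ Kx)/(locally_above oE f_C3 f_M f_f (KE _ Kx))[s [d [s0 d0 dn]]].
  exists (ball x s, [set nd : nat * R |
      (forall y, `|y - x| < s -> f x0 + d <= f_ nd.1 y) /\ nd.2 <= d]).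
    split; first exact: nbhsx_ballx.
    exists ([set n | forall y, `|y - x| < s -> f x0 + d <= f_ n y], [set e | e <= d]) => //.
    by split => //=; exact: nbhs_right_le.
  move=> [y [n e]] /= [xy [yd ed]].
  rewrite (le_trans _ (yd y _)) ?lerD2l//.
  by move: xy; rewrite -ball_normE/= distrC.
have [[A B] /= [An B0] AB] := (compact_near_coveringP _).1 cK' _ _ _ _ nearK'.
near (0:R)^'+ => d.
exists d => //; apply: filterS An => n An y Ky ye.
have := AB (n, d); apply => //=; split => //; near: d.
exact: B0.
Unshelve. all: by end_near. Qed.

Lemma uniformly_above_outside (K : set 'rV[R]_D) (eps : R) : compact K -> K `<=` E ->
  (forall y, K y -> y != x0 -> f x0 < f y) ->
  ((f x0)%:E < limn_einf (fun n =>
           ereal_inf [set (f_ n y)%:E | y in Theta `\` K]))%E -> 0 < eps ->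
  exists2 d : R, 0 < d & \forall n \near \oo, forall y, Theta y -> eps <= `|y - x0| ->
    f x0 + d <= f_ n y.
Proof.
move=> cK KE fK /limn_einf_gt_near[d1 d10 n1] e0.
have [d2 d20 n2] := uniformly_above_on_compact cK KE fK e0.
exists (Num.min d1 d2); first by rewrite lt_min d10 d20.
near=> n => y Ty ye; have [Ky|nKy] := pselect (K y).
  apply: (@le_trans _ _ (f x0 + d2)); first by rewrite lerD2l ge_min lexx orbT.
  by move: y Ky ye {Ty}; near: n.
apply: (@le_trans _ _ (f x0 + d1)); first by rewrite lerD2l ge_min lexx.
rewrite -lee_fin; have := near n1 n; move=> /(_ _)/le_trans; apply => //.
by apply: ereal_inf_lbound; exists y.
Unshelve. all: by end_near. Qed.

Hypothesis posH : posdefmx (hessian f x0).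

(** The constant 16 anticipates expansions around a moving centre: two points of the ball are up to
    [2 * r] apart, so the cubic remainder is still at most [lam / 8] times the squared norm. *)
Lemma good_radius : exists r lam : R, [/\ 0 < r, 0 < lam, cball x0 r `<=` E,
  forall v, lam * sumsq v <= qform (hessian f x0) v & C * r <= lam / 16].
Proof.
have [lam lam0 lamH] := posdefmx_lower posH.
have /nbhs_ballP[rho /= rho0 rhoE] : nbhs x0 E by exact: open_nbhs_nbhs.
have C0 := C_ge0 Ex0.
have C1 : 0 < C + 1 by rewrite ltr_wpDl.
exists (Num.min (rho / 2) (lam / 16 / (C + 1))), lam; split => //.
- by rewrite lt_min !divr_gt0.
- move=> y; rewrite /cball/= le_min => /andP[yr _]; apply: rhoE.
  by rewrite -ball_normE/= distrC (le_lt_trans yr)// ltr_pdivrMr// ltr_pMr// ltr1n.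
- set r := Num.min _ _; have r0 : 0 < r by rewrite lt_min !divr_gt0.
  apply: (@le_trans _ _ ((C + 1) * r)); first by rewrite ler_pM2r// lerDl.
  by rewrite -ler_pdivlMl// mulrC ge_min lexx orbT.
Qed.

(** The compact set is a small ball, on which the uniform quadratic minorant gives strict minimality
    of [f] in the limit. Outside it, convexity propagates the rise of [f_ n] across the boundary
    sphere. *)
Lemma convex_cond_liminf : (forall n, convex_fun_on Theta (f_ n)) ->
  gradient f x0 = 0 ->
  exists K : set 'rV[R]_D,
    [/\ compact K, K `<=` E, interior K x0,
        forall y, K y -> y != x0 -> f x0 < f y &
        ((f x0)%:E < limn_einf (fun n =>
           ereal_inf [set (f_ n y)%:E | y in Theta `\` K]))%E].
Proof.
move=> cvx g0; have [r [lam [r0 lam0 rE lamH Cr]]] := good_radius.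
have x0r : cball x0 r x0 by rewrite /cball/= subrr normr0 ltW.
have vr v : `|v| <= r -> segment_in E x0 v.
  by move=> vr; exact: (cball_segment_in_shift rE x0r (cball_center _ vr)).
have Cr4 : C * r <= lam / 4 by move: (C * r) Cr => ?; lra.
have [eta eta0 lower] := uniform_quadratic_lower oE f_C3 f_M f_f Ex0 g0 (ltW r0) vr lamH Cr4.
exists (cball x0 r); split => //.
- exact: cball_compact.
- apply/nbhs_ballP; exists r => //= y; rewrite -ball_normE/= distrC => yr.
  exact: ltW.
- move=> y yr yx0; rewrite (@lt_le_trans _ _ (f x0 + lam / 4 * `|y - x0| ^+ 2))//.
    by rewrite ltrDl mulr_gt0 ?divr_gt0// exprn_gt0// normr_gt0 subr_eq0.
  apply: (@ler_cvg_to _ \oo _ _ (fun n => f x0 - eta n + lam / 4 * `|y - x0| ^+ 2)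
     (fun n => f_ n y)).
  + rewrite -[X in _ --> X + _](subr0 (f x0)); apply: cvgD; last exact: cvg_cst.
    by apply: cvgB => //; exact: cvg_cst.
  + by apply: f_f; exact: rE.
  + by apply: nearW => n; have := lower n _ yr; rewrite subrKC.
(* The height of the minorant on the sphere of radius [r]. Errors of [d / 4] in [eta n] and in
   [f_ n x0] leave a rise of [d / 2] above [f_ n x0], hence [d / 4] above [f x0]. *)
set d := lam / 4 * r ^+ 2.
have d0 : 0 < d by rewrite mulr_gt0 ?exprn_gt0// divr_gt0.
have d4 : 0 < d / 4 by rewrite divr_gt0.
apply: (@lt_le_trans _ _ (f x0 + d / 4)%:E); first by rewrite lte_fin ltrDl.
apply: near_limn_einf_ge.
have eta_d : \forall n \near \oo, eta n <= d / 4 by exact: (cvgr_le _ eta0).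
have fx0_d : \forall n \near \oo, `|f x0 - f_ n x0| <= d / 4.
  by move/cvgrPdist_le : (f_f Ex0) => /(_ _ d4).
near=> n; apply: le_ereal_inf_tmp => _ [y [Ty /negP yr] <-].
rewrite lee_fin; rewrite -ltNge in yr.
have v0 : 0 < `|y - x0| by rewrite (lt_trans r0).
(* The fraction of the segment from [x0] to [y] at which it crosses the sphere of radius [r]. *)
pose s := r / `|y - x0|.
have s0 : 0 < s by rewrite divr_gt0.
have s1 : s < 1 by rewrite ltr_pdivrMr// mul1r.
have sr : `|s *: (y - x0)| = r.
  by rewrite normrZ gtr0_norm// divfK// gt_eqF.
have xE : s *: y + (1 - s) *: x0 = x0 + s *: (y - x0).
  by apply/rowP => i; rewrite !mxE; ring.
(* The crossing point lies in [E], hence in [Theta], so the convexity inequality may be tested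
   there. *)
have Ex : E (x0 + s *: (y - x0)).
  by apply: rE; rewrite /cball/= addrAC subrr add0r sr.
have := cvx n y x0 s Ty (E_Theta Ex0); rewrite xE (ltW s0) (ltW s1) => /(_ isT (E_Theta Ex)).
have := lower n (s *: (y - x0)); rewrite sr -/d lexx => /(_ isT).
have : eta n <= d / 4 by near: n.
have : `|f x0 - f_ n x0| <= d / 4 by near: n.
move=> /ler_normlP[].
move: (f_ n (x0 + _)) (f_ n y) (f_ n x0) (f x0) (eta n) => a b c g e.
move=> h1 h2 h3 h4 h5.
have : d / 2 <= s * (b - c) by lra.
move=> h6; have bc : 0 <= b - c.
  by rewrite -(pmulr_rge0 _ s0) (le_trans _ h6)// divr_ge0// ltW.
have : s * (b - c) <= b - c by rewrite ler_piMl// ltW.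
by lra.
Unshelve. all: by end_near. Qed.

(** Each [th n] minimizes [f_ n] over one fixed compact ball. The other conclusions feed the Laplace
    argument: quadratic growth on the ball, a gap away from [x0], and the limit of the rescaled
    exponent. *)
Lemma minimizers (K : set 'rV[R]_D) : compact K -> K `<=` E -> interior K x0 ->
  (forall y, K y -> y != x0 -> f x0 < f y) ->
  ((f x0)%:E < limn_einf (fun n =>
           ereal_inf [set (f_ n y)%:E | y in Theta `\` K]))%E ->
  exists (th : nat -> 'rV[R]_D) (r c : R),
  [/\ 0 < r, 0 < c, cball x0 r `<=` E, th n @[n --> \oo] --> x0 &
      f_ n (th n) @[n --> \oo] --> f x0] /\
  [/\ forall n, cball x0 r (th n),
      \forall n \near \oo, gradient (f_ n) (th n) = 0,
      \forall n \near \oo, forall y, cball x0 r y ->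
        c * sumsq (y - th n) <= f_ n y - f_ n (th n),
      forall eps : R, 0 < eps -> exists2 d : R, 0 < d & \forall n \near \oo,
        forall y, Theta y -> eps <= `|y - x0| -> d <= f_ n y - f_ n (th n) &
      forall x, n%:R * (f_ n (th n + (Num.sqrt n%:R)^-1 *: x) - f_ n (th n))
        @[n --> \oo] --> qform (hessian f x0) x / 2].
Proof.
move=> cK KE K0 fK liminfK; have [r [lam [r0 lam0 rE lamH Cr]]] := good_radius.
have C0 := C_ge0 Ex0.
have r20 : 0 < r / 2 by rewrite divr_gt0.
have x0r : cball x0 r x0 by rewrite /cball/= subrr normr0 ltW.
have vr v : `|v| <= r -> segment_in E x0 v.
  by move=> vr; exact: (cball_segment_in_shift rE x0r (cball_center _ vr)).
(* [x0] minimizes [f] on a neighbourhood, and the limit expansion provides the required quadratic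
   estimate. *)
have g0 : gradient f x0 = 0.
  have /nbhs_ballP[s /= s0 sK] := K0.
  apply: (@local_min_gradient0 _ _ f x0 (Num.min s r)
      (sumabs (hessian f x0) / 2 + C * r)) => [|v|v].
  - by rewrite lt_min s0.
  - rewrite lt_min => /andP[vs _]; have [->|v0] := eqVneq v 0; first by rewrite addr0.
    apply/ltW/fK; last by rewrite -subr_eq0 addrAC subrr add0r.
    by apply: sK; rewrite -ball_normE/= opprD addNKr normrN.
  - rewrite lt_min => /andP[_ /ltW vr']; apply: taylor_order1 => //.
    exact: (taylor_rV_lim oE f_C3 f_M f_f Ex0 (vr _ vr')).
have Cr4 : C * r <= lam / 4 by move: (C * r) Cr => ?; lra.
have [eta eta0 lower] := uniform_quadratic_lower oE f_C3 f_M f_f Ex0 g0 (ltW r0) vr lamH Cr4.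
have argmin n : exists t, cball x0 r t /\ forall y, cball x0 r y -> f_ n t <= f_ n y.
  have [|t] := @EVT_min_rV R D (f_ n) _ (ex_intro _ x0 x0r) (@cball_compact x0 r).
    apply: continuous_in_subspaceT => y /set_mem yr; apply: differentiable_continuous.
    by have [] := @f_C3 n _ (rE _ yr).
  move=> /set_mem tr tmin; exists t; split => // y yr; apply: tmin.
  exact: mem_set.
have [th th_argmin] := choice argmin.
have thr n : cball x0 r (th n) by have [] := th_argmin n.
have thmin n y : cball x0 r y -> f_ n (th n) <= f_ n y by have [_] := th_argmin n; apply.
have thlow n : f x0 - eta n + lam / 4 * `|th n - x0| ^+ 2 <= f_ n (th n).
  by have := lower n _ (thr n); rewrite subrKC.
(* Comparing [f_ n (th n)] with [f_ n x0] shows that this sequence bounds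
   [lam / 4 * |th n - x0| ^+ 2], so it controls the distance to [x0]. *)
have gap0 : eta n + (f_ n x0 - f x0) @[n --> \oo] --> (0:R).
  rewrite -[X in _ --> X]addr0; apply: cvgD => //.
  by rewrite -[X in _ --> X](subrr (f x0)); apply: cvgB; [exact: f_f|exact: cvg_cst].
have l4 : 0 < lam / 4 by rewrite divr_gt0.
have th_cvg : th n @[n --> \oo] --> x0.
  apply/cvgrPdist_le => e e0.
  have : \forall n \near \oo, eta n + (f_ n x0 - f x0) <= lam / 4 * e ^+ 2.
    by apply: (cvgr_le _ gap0); rewrite mulr_gt0// exprn_gt0.
  apply: filterS => n gapn; rewrite distrC.
  rewrite -(@ler_pXn2r _ 2)// ?nnegrE ?(ltW e0)// -(ler_pM2l l4) (le_trans _ gapn)//.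
  have := le_trans (thlow n) (thmin n _ x0r).
  by move: (lam / 4 * _) => ?; lra.
have fth_cvg : f_ n (th n) @[n --> \oo] --> f x0.
  apply: (@squeeze_cvgr _ _ _ _ (fun n => f x0 - eta n) (fun n => f_ n x0)).
  - apply: nearW => n; rewrite (thmin n _ x0r) andbT (le_trans _ (thlow n))// lerDl.
    by rewrite mulr_ge0 ?(ltW l4)// sqr_ge0.
  - by rewrite -[X in _ --> X](subr0 (f x0)); apply: cvgB => //; exact: cvg_cst.
  - exact: f_f.
(* From here on steps of norm at most [r / 2] stay in the ball, so the minimum is interior. *)
have th_half : \forall n \near \oo, cball x0 (r / 2) (th n).
  move/cvgrPdist_le : th_cvg => /(_ _ r20); apply: filterS => n.
  by rewrite /cball/= distrC.
have grad_th : \forall n \near \oo, gradient (f_ n) (th n) = 0.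
  apply: filterS th_half => n thn.
  apply: (@local_min_gradient0 _ _ (f_ n) (th n) (r / 2)
      (sumabs (hessian (f_ n) (th n)) / 2 + C * (r / 2))) => // v /ltW v2.
    by apply: thmin; exact: cball_half.
  apply: taylor_order1 => //; apply: (taylor_rV (f_C3 n) (f_M n)).
  by apply: (cball_segment_in_shift rE); [exact: thr|exact: cball_half].
pose taylor_bound n := forall v, cball x0 r (th n + v) ->
    `|f_ n (th n + v) - f_ n (th n) - qform (hessian (f_ n) (th n)) v / 2|
       <= C * `|v| ^+ 3.
have taylor_th : \forall n \near \oo, taylor_bound n.
  apply: filterS grad_th => n gn v nv.
  have := taylor_rV (f_C3 n) (f_M n) (cball_segment_in_shift rE (thr n) nv).
  rewrite (_ : \sum_i _ = 0) ?subr0// big1// => i _; move/rowP : gn => /(_ i).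
  by rewrite /gradient [LHS]mxE [RHS]mxE => ->; rewrite mulr0.
(* Second partials are Lipschitz with a constant independent of [n], which transfers convergence
   from [x0] to the moving point [th n]. *)
have hess_th i j : hessian (f_ n) (th n) i j @[n --> \oo] --> hessian f x0 i j.
  rewrite (_ : (fun n => _) = (fun n => (hessian (f_ n) (th n) i j - hessian (f_ n) x0 i j)
     + hessian (f_ n) x0 i j)); last by apply/funext => n; rewrite subrK.
  rewrite -[X in _ --> X]add0r; apply: cvgD; last exact: (cvg_hessian oE f_C3 f_M f_f).
  apply: (@cvg0_norm_le _ (fun n => D%:R * `|th n - x0| * M)).
    apply: nearW => n.
    have -> : hessian (f_ n) (th n) i j - hessian (f_ n) x0 i j =
        partial i (partial j (f_ n)) (th n) - partial i (partial j (f_ n)) x0.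
      by congr (_ - _); exact: hessianE.
    have := @partial2_lipschitz _ _ _ _ _ (f_C3 n) (f_M n) x0 (th n - x0) i j.
    by rewrite subrKC; apply; exact: (cball_segment_in rE x0r (thr n)).
  rewrite [X in _ --> X](_ : 0 = D%:R * 0 * M); last by rewrite mulr0 mul0r.
  apply: cvgMl; apply: cvgMr; rewrite -[X in _ --> X](@normr0 _ 'rV[R]_D).
  apply: cvg_norm; rewrite -[X in _ --> X](subrr x0).
  by apply: cvgB => //; exact: cvg_cst.
have hess_dist := cvg_sumabs_dist hess_th.
exists th, r, (lam / 4); split => //; split => //.
- have : \forall n \near \oo, sumabs (hessian (f_ n) (th n) - hessian f x0) <= lam / 4.
    exact: (cvgr_le _ hess_dist).
  move=> dist_n; near=> n => y yr.
  have : sumabs (hessian (f_ n) (th n) - hessian f x0) <= lam / 4 by near: n.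
  have /(_ (y - th n)) : taylor_bound n by near: n.
  rewrite subrKC => /(_ yr) T G.
  set v := y - th n in T *.
  have v2r : `|v| <= 2 * r.
    rewrite /v -(subrKA x0) (le_trans (ler_normD _ _))// mulr2n mulrDl !mul1r lerD//.
    by rewrite distrC; exact: thr.
  have S2 := norm2_le_sumsq v; have lamv := lamH v.
  have : - (qform (hessian (f_ n) (th n)) v - qform (hessian f x0) v) <= lam / 4 * sumsq v.
    rewrite -qformB (le_trans (ler_norm _))// normrN (le_trans (qform_bound _ _))//.
    by rewrite ler_pM ?sumabs_ge0 ?sqr_ge0.
  have : C * `|v| ^+ 3 <= lam / 8 * sumsq v.
    rewrite exprS mulrA; apply: ler_pM => //; first by apply: mulr_ge0.
    apply: (@le_trans _ _ (C * (2 * r))); first exact: ler_wpM2l.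
    by rewrite mulrCA; move: (C * r) Cr => ?; lra.
  move=> cubic quad; have /ler_normlP[T1 _] := T.
  exact: (quadratic_lower_arith lamv T1 cubic quad).
- move=> eps eps0.
  have [d d0 dn] := uniformly_above_outside cK KE fK liminfK eps0.
  exists (d / 2); first by rewrite divr_gt0.
  have fth_d : \forall n \near \oo, f_ n (th n) <= f x0 + d / 2.
    by apply: (cvgr_le _ fth_cvg); rewrite ltrDl divr_gt0.
  near=> n => y Ty ye.
  have : f_ n (th n) <= f x0 + d / 2 by near: n.
  have : f x0 + d <= f_ n y by move: y Ty ye; near: n.
  by move: (f_ n y) (f_ n _) (f x0) => ? ? ?; lra.
(* After the quadratic form is subtracted, the cubic remainder at [x / sqrt n], multiplied by [n],
   is of order [1 / sqrt n]. *)
- move=> x; rewrite (_ : (fun n => _) = fun n =>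
     (n%:R * (f_ n (th n + (Num.sqrt n%:R)^-1 *: x) - f_ n (th n))
        - qform (hessian (f_ n) (th n)) x / 2)
       + qform (hessian (f_ n) (th n)) x / 2); last first.
    by apply/funext => n; rewrite subrK.
  rewrite -[X in _ --> X]add0r; apply: cvgD; last first.
    apply: cvgMl; under eq_fun do rewrite qformE; rewrite qformE.
    apply: cvg_big => [|i _]; first exact: add_continuous.
    apply: cvg_big => [|j _]; first exact: add_continuous.
    by apply: cvgMr; exact: hess_th.
  have x_small : \forall n \near \oo, (Num.sqrt (n%:R : R))^-1 * `|x| <= r / 2.
    apply: (cvgr_le 0) => //; rewrite -[X in _ --> X](mul0r `|x|).
    by apply: cvgMl; exact: cvg_sqrtn_inv.
  apply: (@cvg0_norm_le _ (fun n => C * `|x| ^+ 3 * (Num.sqrt (n%:R : R))^-1)); last first.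
    by rewrite -[X in _ --> X](mulr0 (C * `|x| ^+ 3)); apply: cvgMr; exact: cvg_sqrtn_inv.
  near=> n.
  have n0 : (0 < n%:R :> R) by near: n; exact: nbhs_infty_gtr.
  have sn0 : 0 < Num.sqrt (n%:R : R) by rewrite sqrtr_gt0.
  have sxr : (Num.sqrt (n%:R : R))^-1 * `|x| <= r / 2 by near: n.
  have thn : cball x0 (r / 2) (th n) by near: n.
  have T : taylor_bound n by near: n.
  set s := (Num.sqrt (n%:R : R))^-1 in sxr *.
  have s0 : 0 < s by rewrite invr_gt0.
  have ns2 : n%:R * s ^+ 2 = 1 by rewrite exprVn sqr_sqrtr ?ltW// divff// gt_eqF.
  have sx : `|s *: x| = s * `|x| by rewrite normrZ gtr0_norm.
  have {}T : `|f_ n (th n + s *: x) - f_ n (th n) - qform (hessian (f_ n) (th n)) (s *: x) / 2|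
       <= C * `|s *: x| ^+ 3.
    by apply: T; apply: cball_half => //; rewrite sx.
  rewrite (_ : _ - _ = n%:R * (f_ n (th n + s *: x) - f_ n (th n) -
     qform (hessian (f_ n) (th n)) (s *: x) / 2)).
    rewrite normrM (ger0_norm (ltW n0)).
    rewrite (le_trans (ler_wpM2l (ltW n0) T))// sx.
    have -> : n%:R * (C * (s * `|x|) ^+ 3) = n%:R * s ^+ 2 * (C * `|x| ^+ 3 * s).
      by move: C (`|x|) => C' z; ring.
    by rewrite ns2 mul1r.
  rewrite qformZ [RHS]mulrBr; congr (_ - _).
  by rewrite -[s ^+ 2 * _ * _]mulrA [RHS]mulrA ns2 mul1r.
Unshelve. all: by end_near. Qed.

End tails.

(** * Lebesgue integrals on R^n *)

Section integral_rV.
Context {R : realType}.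
Local Open Scope ereal_scope.

(** Tonelli for the product measure behind [lebesgue_rV n.+1], with the first coordinate integrated
    innermost. *)
Lemma ge0_integral_rVS n (F : 'rV[R]_n.+1 -> \bar R) :
  measurable_fun setT F -> (forall x, 0 <= F x) ->
  \int[lebesgue_rV n.+1]_x F x =
  \int[lebesgue_rV n]_y \int[lebesgue_measure]_t F (rV_cons (t, y)).
Proof.
move=> mF F0.
have mFc : measurable_fun setT (F \o @rV_cons R n).
  exact: measurableT_comp mF (@measurable_rV_cons _ _).
transitivity (\int[pushforward (lebesgue_measure \x lebesgue_rV n) (@rV_cons R n)]_x F x) => //.
rewrite ge0_integral_pushforward//; last exact: measurable_rV_cons.
rewrite preimage_setT.
exact: (@fubini_tonelli2 _ _ _ _ R lebesgue_measure (lebesgue_rV n) _ mFc (fun=> F0 _)).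
Qed.

Lemma measurable_fun_integral_rV_cons n (F : 'rV[R]_n.+1 -> \bar R) :
  measurable_fun setT F -> (forall x, 0 <= F x) ->
  measurable_fun setT (fun y => \int[lebesgue_measure]_t F (rV_cons (t, y))).
Proof.
move=> mF F0.
have mFc : measurable_fun setT (F \o @rV_cons R n).
  exact: measurableT_comp mF (@measurable_rV_cons _ _).
exact: (@measurable_fun_fubini_tonelli_G _ _ _ _ R lebesgue_measure _ mFc (fun=> F0 _)).
Qed.

(** The pushforward of Lebesgue measure under the affine map, multiplied by [s], agrees with
    Lebesgue measure on half-open intervals, hence everywhere by uniqueness. *)
Lemma ge0_integral_affine (a s : R) (g : R -> \bar R) : (0 < s)%R ->
  measurable_fun setT g -> (forall t, 0 <= g t) ->
  \int[lebesgue_measure]_t g t = s%:E * \int[lebesgue_measure]_t g (a + s * t)%R.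
Proof.
move=> s0 mg g0; pose phi (t : R) := (a + s * t)%R.
have mphi : measurable_fun setT (phi : measurableTypeR R -> measurableTypeR R).
  by apply: measurable_funD => //; exact: measurable_funM.
pose k := NngNum (ltW s0).
have scaleE (X : set R) : measurable X ->
    lebesgue_measure X = mscale k (pushforward lebesgue_measure (phi : measurableTypeR R -> measurableTypeR R)) X.
  apply: lebesgue_measure_unique => _ [[x y] _ <-] /=.
  rewrite /mscale /= /pushforward.
  rewrite (_ : phi @^-1` _ = [set` `](x - a) / s, (y - a) / s]%R]); last first.
    apply/seteqP; split => t /=; rewrite !in_itv/= /phi.
      by move=> /andP[xt ty]; rewrite ltr_pdivrMr// ler_pdivlMr//; apply/andP; split; lra.
    by rewrite ltr_pdivrMr// ler_pdivlMr// => /andP[xt ty]; apply/andP; split; lra.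
  rewrite !lebesgue_measure_itv/= !lte_fin ltr_pM2r ?invr_gt0// ltrD2r.
  case: ifPn => _; last by rewrite mule0.
  rewrite -!EFinB -EFinM; congr (_%:E); field; exact: lt0r_neq0.
rewrite (eq_measure_integral (mscale k (pushforward lebesgue_measure (phi : measurableTypeR R -> measurableTypeR R)))) => [|A mA _]; last first.
  exact: scaleE.
by rewrite ge0_integral_mscale//= ge0_integral_pushforward// preimage_setT.
Qed.

Lemma measurable_affine_rV n (a : 'rV[R]_n) (s : R) :
  measurable_fun setT (fun x : 'rV[R]_n => a + s *: x)%R.
Proof.
apply/measurable_fun_rVP => i; under eq_fun do rewrite !mxE.
by apply: measurable_funD => //; apply: measurable_funM => //; exact: measurable_coord.
Qed.

Lemma ge0_integral_rV_affine n (a : 'rV[R]_n) (s : R) (F : 'rV[R]_n -> \bar R) :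
  (0 < s)%R -> measurable_fun setT F -> (forall x, 0 <= F x) ->
  \int[lebesgue_rV n]_x F x = (s ^+ n)%:E * \int[lebesgue_rV n]_x F (a + s *: x)%R.
Proof.
move=> s0; elim: n a F => [|n IH] a F mF F0.
  rewrite expr0 mul1e; apply: eq_integral => x _.
  by congr F; rewrite [x]thinmx0 [RHS]thinmx0.
have mFa : measurable_fun setT (fun x : 'rV[R]_n.+1 => F (a + s *: x)%R).
  exact: measurableT_comp mF (measurable_affine_rV _ _).
rewrite !ge0_integral_rVS//.
pose a' : 'rV[R]_n := \row_i a ord0 (lift ord0 i).
have affE t y : (a + s *: rV_cons (t, y) =
    rV_cons (a ord0 ord0 + s * t, a' + s *: y)%R)%R.
  apply/rowP => i; rewrite [LHS]mxE [X in (_ + X)%R]mxE.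
  case: (unliftP ord0 i) => [j|] ->; last by rewrite !rV_cons0.
  by rewrite !rV_consS /= !mxE.
under eq_integral => y _.
  rewrite (@ge0_integral_affine (a ord0 ord0) s)//; last first.
    apply: measurableT_comp mF _.
    exact: measurableT_comp (@measurable_rV_cons _ _) (measurable_pair2 _).
  over.
have mG (G : 'rV[R]_n.+1 -> \bar R) : measurable_fun setT G -> (forall x, 0 <= G x) ->
    measurable_fun setT (fun y : 'rV[R]_n => s%:E * \int[lebesgue_measure]_t G (rV_cons (t, y))).
  by move=> *; apply: measurable_funeM; exact: measurable_fun_integral_rV_cons.
(* [H] acts on the first coordinate only; the induction hypothesis at [a'] handles the others. *)
pose H (x : 'rV[R]_n.+1) : 'rV[R]_n.+1 :=
  (\row_i (if i == ord0 then a ord0 ord0 + s * x ord0 ord0 else x ord0 i))%R.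
have mH : measurable_fun setT H.
  apply/measurable_fun_rVP => i; under eq_fun do rewrite mxE.
  case: (i == ord0); last exact: measurable_coord.
  by apply: measurable_funD => //; apply: measurable_funM => //; exact: measurable_coord.
have HE t y : H (rV_cons (t, y)) = rV_cons ((a ord0 ord0 + s * t)%R, y).
  apply/rowP => i; rewrite mxE.
  case: (unliftP ord0 i) => [j|] ->; last by rewrite eqxx !rV_cons0.
  by rewrite eq_sym (negbTE (neq_lift ord0 j)) !rV_consS.
under eq_integral => y _ do under eq_integral => t _ do rewrite -HE.
rewrite [LHS](IH a').
- rewrite exprSr EFinM -muleA; congr (_ * _).
  transitivity (\int[lebesgue_rV n]_y
      (s%:E * \int[lebesgue_measure]_t F (a + s *: rV_cons (t, y))%R)).
    by apply: eq_integral => y _; congr (_ * _); apply: eq_integral => t _; rewrite affE HE.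
  apply: (@ge0_integralZl _ _ _ (lebesgue_rV n) setT measurableT
    (fun y : 'rV[R]_n => \int[lebesgue_measure]_t F (a + s *: rV_cons (t, y))%R)).
  + exact: (measurable_fun_integral_rV_cons mFa (fun=> F0 _)).
  + by move=> y _; exact: integral_ge0.
  + by rewrite lee_fin ltW.
- exact: (mG (F \o H) (measurableT_comp mF mH) (fun=> F0 _)).
- by move=> y; rewrite mule_ge0 ?lee_fin ?(ltW s0)//; exact: integral_ge0.
Qed.

End integral_rV.

Lemma mul_rV_tr {K : comNzRingType} n (u v : 'rV[K]_n) :
  u *m v^T = ((v *m u^T) ord0 ord0)%:M.
Proof.
apply/matrixP => i j; rewrite !ord1 !mxE eqxx mulr1n.
by apply: eq_bigr => k _; rewrite !mxE mulrC.
Qed.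

(** * Schur complement of the top left entry *)

Section schur.
Context {R : realType} {n : nat}.
Variable A : 'M[R]_(1 + n).

Let a : R := A ord0 ord0.
Let b : 'rV[R]_n := ursubmx A.

(** For positive definite [A], the form left after minimizing over the first coordinate. The size is
    written [1 + n] to give access to blocks; it is convertible to [n.+1]. *)
Definition schur_compl : 'M[R]_n := drsubmx A - a^-1 *: (b^T *m b).

Hypothesis posA : posdefmx A.

Let symA : A^T = A := posA.1.

Let ulE : ulsubmx A = a%:M.
Proof.
rewrite [LHS]mx11_scalar; congr (_%:M); rewrite mxE mxE.
by congr (A _ _); exact: val_inj.
Qed.

Let dlE : dlsubmx A = b^T.
Proof. by rewrite /b trmx_ursub symA. Qed.

Lemma qform_rV_cons (t : R) (y : 'rV[R]_n) :
  qform (A : 'M[R]_n.+1) (rV_cons (t, y)) =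
  a * t ^+ 2 + 2 * ((b *m y^T) ord0 ord0) * t + qform (drsubmx A) y.
Proof.
rewrite /qform /rV_cons /=.
have -> : const_mx t = t%:M :> 'M[R]_1 by rewrite [LHS]mx11_scalar mxE.
have yb := mul_rV_tr y b.
pose x : 'rV[R]_(1 + n) := row_mx t%:M y.
suff : (x *m A *m x^T) ord0 ord0 = a * t ^+ 2 +
    2 * (b *m y^T) ord0 ord0 * t + (y *m drsubmx A *m y^T) ord0 ord0 by [].
rewrite -{1}(submxK A) ulE dlE /x tr_row_mx mul_row_block mul_row_col yb.
rewrite tr_scalar_mx mulmxDl mulmxDl -!scalar_mxM -mulmxA.
rewrite [b *m y^T in LHS]mx11_scalar -scalar_mxM !mxE !eqxx !mulr1n.
by rewrite addrA; ring.
Qed.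

Lemma qform_schur_compl (y : 'rV[R]_n) :
  qform schur_compl y = qform (drsubmx A) y - ((b *m y^T) ord0 ord0) ^+ 2 / a.
Proof.
rewrite qformB; congr (_ - _); rewrite /qform -scalemxAr -scalemxAl mxE mulrC.
congr (_ * _); rewrite (mulmxA y) -(mulmxA _ b) (mul_rV_tr y b).
by rewrite [X in _ *m X]mx11_scalar -scalar_mxM mxE eqxx mulr1n expr2.
Qed.

Lemma posdefmx_diag0_gt0 : 0 < a.
Proof.
have [_ /(_ (delta_mx ord0 ord0))] := posA.
have -> : 0 < a = (0 < qform A (1 *: delta_mx ord0 ord0)).
  by rewrite qform_scale_delta expr1n mul1r.
rewrite scale1r; apply; apply/eqP => /rowP/(_ ord0)/eqP.
by rewrite !mxE !eqxx oner_eq0.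
Qed.

Lemma posdefmx_schur_compl : posdefmx schur_compl.
Proof.
split.
  rewrite /schur_compl [LHS]raddfB/= trmx_drsub symA; congr (_ - _).
  by rewrite linearZ/= trmx_mul trmxK.
move=> y y0; rewrite -/(qform _ y) qform_schur_compl.
have a0 := posdefmx_diag0_gt0.
set beta := (b *m y^T) ord0 ord0.
(* The first coordinate [- beta / a] minimizes the form for fixed [y]; there the form of [A] equals
   that of the Schur complement. *)
have : 0 < qform (A : 'M[R]_n.+1) (rV_cons (- beta / a, y)).
  apply: posA.2; apply: contraNneq y0 => /rowP c0; apply/eqP/rowP => i.
  by have := c0 (lift ord0 i); rewrite rV_consS !mxE.
rewrite qform_rV_cons -/beta.
by congr (0 < _); move: (qform _ _) => q; field; exact: lt0r_neq0.
Qed.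

(** Multiplying on the left by a unipotent lower triangular block matrix clears the column below
    [a]. *)
Lemma det_schur_compl : \det A = a * \det schur_compl.
Proof.
have a0 : a != 0 by rewrite gt_eqF// posdefmx_diag0_gt0.
have := congr1 determinant (mulmx_block 1%:M 0 (- a^-1 *: b^T) 1%:M a%:M b b^T (drsubmx A)).
rewrite det_mulmx det_lblock !det1 !mul1r.
rewrite -ulE -dlE submxK => ->.
rewrite !mul1mx !mul0mx !addr0 ulE dlE.
rewrite (_ : _ + b^T = 0) ?det_ublock; last first.
  by rewrite mul_mx_scalar scalerA mulrN mulfV// scaleN1r addNr.
rewrite det_scalar1; congr (_ * \det _).
by rewrite addrC -scalemxAl scaleNr.
Qed.

End schur.

(** * Gaussian integrals *)

Section gaussian_integral.
Context {R : realType}.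
Local Open Scope ereal_scope.

(** Completing the square exhibits a multiple of the normal density with mean [- b / a] and variance
    [a^-1]. *)
Lemma integral_gauss_quadratic (a b : R) : (0 < a)%R ->
  \int[lebesgue_measure]_t (expR (- (a * t ^+ 2 + 2 * b * t) / 2))%:E =
  (Num.sqrt (2 * pi / a) * expR (b ^+ 2 / a / 2))%:E.
Proof.
move=> a0; pose m := (- b / a)%R; pose s := (Num.sqrt a^-1)%R.
have s0 : (s != 0)%R by rewrite gt_eqF// sqrtr_gt0 invr_gt0.
have s2 : (s ^+ 2 = a^-1)%R by rewrite sqr_sqrtr// invr_ge0 ltW.
have pk : (normal_peak s = (Num.sqrt (2 * pi / a))^-1)%R.
  by rewrite /normal_peak s2 -mulr_natr; congr ((Num.sqrt _)^-1)%R; ring.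
have k0 : (0 < Num.sqrt (2 * pi / a) :> R)%R.
  by rewrite sqrtr_gt0 divr_gt0// mulr_gt0// pi_gt0.
transitivity (\int[lebesgue_measure]_t
    ((Num.sqrt (2 * pi / a) * expR (b ^+ 2 / a / 2))%:E * (normal_pdf m s t)%:E)).
  apply: eq_integral => t _; rewrite normal_pdfE// -EFinM; congr (_%:E).
  rewrite pk /normal_fun s2 mulrACA mulfV ?gt_eqF// mul1r -expRD.
  congr expR; rewrite /m; field; exact: lt0r_neq0.
rewrite ge0_integralZl//=.
- by rewrite integral_normal_pdf mule1.
- by apply/measurable_EFinP; exact: measurable_normal_pdf.
- by move=> t _; rewrite lee_fin normal_pdf_ge0.
Qed.

Lemma measurable_qform n (A : 'M[R]_n) : measurable_fun setT (qform A).
Proof.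
rewrite (_ : qform A = fun x => (\sum_i \sum_j x ord0 i * x ord0 j * A i j)%R);
  last by apply/funext => x; exact: qformE.
apply: measurable_sum => i; apply: measurable_sum => j.
apply: measurable_funM => //; apply: measurable_funM; exact: measurable_coord.
Qed.

Lemma measurable_gauss_rV n (A : 'M[R]_n) :
  measurable_fun setT (fun x : 'rV[R]_n => expR (- qform A x / 2)).
Proof.
apply: measurableT_comp => //; apply: measurable_funM => //.
exact: (measurableT_comp (@oppr_measurable R setT) (measurable_qform A)).
Qed.

(** Integrating out the first coordinate leaves the Gaussian of the Schur complement, and the two
    constants multiply by [det_schur_compl]. Positivity of the determinant is carried through the
    same induction. *)
Lemma gaussian_integral_rV n (A : 'M[R]_n) : posdefmx A ->
  (0 < \det A)%R /\
  \int[lebesgue_rV n]_x (expR (- qform A x / 2))%:E =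
    (Num.sqrt ((2 * pi) ^+ n / \det A))%:E.
Proof.
elim: n A => [A _|n IH A posA].
  rewrite det_mx00; split => //; rewrite expr0 divr1 sqrtr1.
  rewrite (_ : (fun x => _) = cst 1); last first.
    by apply/funext => x; rewrite [x]thinmx0 qform0 oppr0 mul0r expR0.
  by rewrite integral_cst// mul1e /= diracT.
have a0 := @posdefmx_diag0_gt0 R n A posA.
have detA := @det_schur_compl R n A posA.
have [S0 IS] := IH _ (@posdefmx_schur_compl R n A posA).
split; first by rewrite detA mulr_gt0.
have mA : measurable_fun setT (fun x : 'rV[R]_n.+1 => (expR (- qform A x / 2))%:E).
  by apply/measurable_EFinP; exact: measurable_gauss_rV.
rewrite ge0_integral_rVS//.
transitivity (\int[lebesgue_rV n]_y ((Num.sqrt (2 * pi / A ord0 ord0))%:E *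
   (expR (- qform (@schur_compl R n A) y / 2))%:E)).
  apply: eq_integral => y _.
  under eq_integral => t _.
    rewrite (@qform_rV_cons R n A posA) opprD mulrDl expRD EFinM muleC.
    over.
  rewrite ge0_integralZl//=.
  - rewrite integral_gauss_quadratic// -!EFinM; congr (_%:E).
    rewrite mulrCA -expRD; congr (_ * expR _)%R.
    rewrite (@qform_schur_compl R n A); move: (qform _ y) (_ ^+ 2 / _)%R => q w.
    by ring.
  - apply/measurable_EFinP; apply: measurableT_comp => //; apply: measurable_funM => //.
    apply: (measurableT_comp (@oppr_measurable R setT)); apply: measurable_funD; apply: measurable_funM => //; exact: measurable_funX.
rewrite ge0_integralZl//=.
- rewrite IS -EFinM -sqrtrM ?detA; last by rewrite divr_ge0 ?(ltW a0)// mulr_ge0// pi_ge0.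
  by congr ((Num.sqrt _)%:E); rewrite exprS invfM mulrACA.
- by apply/measurable_EFinP; exact: measurable_gauss_rV.
Qed.

End gaussian_integral.

(** * L1 convergence and normalization *)

Section L1_convergence.
Context d (T : measurableType d) (R : realType) (mu : {measure set T -> \bar R}).
Local Open Scope ereal_scope.

(** Dominated convergence applies to [g_ n] cut off to [A_ n]; the discarded part adds at most the
    integral of [g_ n] off [A_ n]. *)
Lemma cvg_L1_dominated_on (g_ : nat -> T -> R) (g h : T -> R) (A_ : nat -> set T) :
  (forall n, measurable_fun setT (g_ n)) -> measurable_fun setT g ->
  (forall n x, (0 <= g_ n x)%R) -> (forall n, measurable (A_ n)) ->
  mu.-integrable setT (EFin \o h) ->
  (\forall n \near \oo, forall x, A_ n x -> (g_ n x <= h x)%R) ->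
  (forall x, (0 <= h x)%R) ->
  (forall x, \forall n \near \oo, A_ n x) ->
  (forall x, g_ n x @[n --> \oo] --> g x) ->
  \int[mu]_(x in ~` A_ n) (g_ n x)%:E @[n --> \oo] --> 0 ->
  \int[mu]_x `|g_ n x - g x|%:E @[n --> \oo] --> 0.
Proof.
move=> mg_ mg g0 mA ih [N _ gh] h0 Ax gx tail.
pose G n x := (g_ n x * \1_(A_ n) x)%R.
have mG n : measurable_fun setT (G n).
  by apply: measurable_funM => //; exact: measurable_indic.
have GE n x : A_ n x -> G n x = g_ n x.
  by move=> Anx; rewrite /G indicE mem_set// mulr1.
have mGd n : measurable_fun setT (fun x => `|G n x - g x|%:E).
  by apply/measurable_EFinP; apply: measurableT_comp => //; exact: measurable_funB.
have G_cvg x : G n x @[n --> \oo] --> g x.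
  apply: cvg_trans (gx x); apply: near_eq_cvg.
  by move: (Ax x); apply: filterS => n Anx; rewrite GE.
(* The envelope is only available from rank [N] on, hence the shifted index. *)
have dom : \int[mu]_x `|(G (n + N)%N x)%:E - (g x)%:E| @[n --> \oo] --> 0.
  have [||||| _ + _] := @dominated_convergence _ _ _ mu setT measurableT
     (fun n x => (G (n + N)%N x)%:E) (EFin \o g) (EFin \o h).
  - by move=> n; apply/measurable_EFinP; exact: mG.
  - exact/measurable_EFinP.
  - apply: aeW => x _ /=; apply: cvg_EFin; first exact: nearW.
    by rewrite (@cvg_shiftn N _ (fun n => G n x)); exact: G_cvg.
  - exact: ih.
  - apply: aeW => x n _ /=; rewrite lee_fin /G indicE.
    case: (boolP (x \in A_ (n + N)%N)) => [/set_mem Anx|_]; last by rewrite mulr0 normr0.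
    by rewrite mulr1 ger0_norm// gh//= leq_addl.
  - by apply.
have {}dom : \int[mu]_x `|(G n x)%:E - (g x)%:E| @[n --> \oo] --> 0.
  by rewrite -(@cvg_shiftn N _ (fun n => \int[mu]_x `|(G n x)%:E - (g x)%:E|)).
have sum0 : \int[mu]_x `|(G n x)%:E - (g x)%:E| + \int[mu]_(x in ~` A_ n) (g_ n x)%:E
    @[n --> \oo] --> 0.
  by rewrite -[X in _ --> X]adde0; exact: cvgeD.
apply: (@squeeze_cvge _ _ _ _ (fun=> 0) _ _ _ _ (cvg_cst _) sum0).
apply: nearW => n; rewrite integral_ge0//=.
rewrite [X in _ <= _ + X]integral_mkcond -ge0_integralD//.
- apply: ge0_le_integral => //=.
  + apply/measurable_EFinP; apply: measurableT_comp => //; exact: measurable_funB.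
  + apply: emeasurable_funD.
      exact: mGd.
    apply/(measurable_restrictT _ (measurableC (mA n))).
    by apply: measurable_funTS; exact/measurable_EFinP.
  + move=> x _; rewrite patchE in_setC.
    case: ifPn => xA.
      rewrite -EFinD lee_fin /G indicE (negbTE xA) mulr0 sub0r normrN.
      by rewrite (le_trans (ler_normB _ _))// addrC lerD2l ger0_norm.
    rewrite negbK in xA; rewrite adde0 lee_fin GE//; exact: set_mem.
- by move=> x _; rewrite patchE; case: ifPn => _ //; rewrite lee_fin.
- apply/(measurable_restrictT _ (measurableC (mA n))).
  by apply: measurable_funTS; exact/measurable_EFinP.
Qed.

Variables (g_ : nat -> T -> R) (g : T -> R) (J : R).
Hypothesis mg_ : forall n, measurable_fun setT (g_ n).
Hypothesis mg : measurable_fun setT g.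
Hypothesis g_ge0 : forall n x, (0 <= g_ n x)%R.
Hypothesis g0 : forall x, (0 <= g x)%R.
Hypothesis gJ : \int[mu]_x (g x)%:E = J%:E.
Hypothesis J0 : (0 < J)%R.
Hypothesis L1 : \int[mu]_x `|g_ n x - g x|%:E @[n --> \oo] --> 0.

Let mdist n : measurable_fun setT (fun x => `|g_ n x - g x|%:E).
Proof.
by apply/measurable_EFinP; apply: measurableT_comp => //; exact: measurable_funB.
Qed.

(** The two bounds are additive rather than a difference of integrals, since [g_ n] may have
    infinite integral for finitely many [n]. *)
Lemma cvg_integral_L1 : \int[mu]_x (g_ n x)%:E @[n --> \oo] --> J%:E.
Proof.
have mgE : measurable_fun setT (fun x => (g x)%:E) by exact/measurable_EFinP.
have mg_E n : measurable_fun setT (fun x => (g_ n x)%:E) by exact/measurable_EFinP.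
have up n : \int[mu]_x (g_ n x)%:E <= J%:E + \int[mu]_x `|g_ n x - g x|%:E.
  rewrite -gJ -ge0_integralD//=; last by move=> x _; rewrite lee_fin.
  apply: ge0_le_integral => //=.
  - by move=> x _; rewrite lee_fin.
  - exact: emeasurable_funD.
  - move=> x _; rewrite -EFinD lee_fin -lerBlDl; exact: ler_norm.
have lo n : J%:E <= \int[mu]_x (g_ n x)%:E + \int[mu]_x `|g_ n x - g x|%:E.
  rewrite -gJ -ge0_integralD//=; last by move=> x _; rewrite lee_fin.
  apply: ge0_le_integral => //=.
  - by move=> x _; rewrite lee_fin.
  - apply: emeasurable_funD => //; exact: mg_E.
  - by move=> x _; rewrite -EFinD lee_fin -lerBlDl distrC; exact: ler_norm.
have /fine_cvgP[finD D0] := L1.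
have bounds : \forall n \near \oo,
   J%:E - \int[mu]_x `|g_ n x - g x|%:E <= \int[mu]_x (g_ n x)%:E <=
   J%:E + \int[mu]_x `|g_ n x - g x|%:E.
  by apply: filterS finD => n fn; rewrite up andbT leeBlDr.
apply: (squeeze_cvge bounds).
  rewrite -[X in _ --> X]sube0; apply: cvgeB => //; exact: cvg_cst.
by rewrite -[X in _ --> X]adde0; apply: cvgeD => //; exact: cvg_cst.
Qed.

(** The difference splits into [(g_ n - g) / I n] and [((I n)^-1 - J^-1) * g], each tending to 0 in
    L1. *)
Lemma cvg_L1_normalized :
  \int[mu]_x `|g_ n x / fine (\int[mu]_x (g_ n x)%:E) - g x / J|%:E @[n --> \oo] --> 0.
Proof.
pose I n := fine (\int[mu]_x (g_ n x)%:E).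
have /fine_cvgP[finI IJ] := cvg_integral_L1.
have /fine_cvgP[finD D0] := L1.
pose D n := fine (\int[mu]_x `|g_ n x - g x|%:E).
have I0 : \forall n \near \oo, (0 < I n)%R by exact: (cvgr_gt _ IJ).
have VIJ : (I n)^-1%R @[n --> \oo] --> J^-1%R by apply: cvgV => //; exact: lt0r_neq0.
have bound0 : (D n * (I n)^-1 + J * `|(I n)^-1 - J^-1|)%:E @[n --> \oo] --> 0.
  apply: cvg_EFin; first exact: nearW.
  rewrite [X in _ --> X](_ : 0 = 0 * J^-1 + J * 0)%R; last by rewrite mul0r mulr0 addr0.
  apply: cvgD; first exact: cvgM.
  apply: cvgMr; rewrite -[X in _ --> X](@normr0 _ R); apply: cvg_norm.
  by rewrite -[X in _ --> X](subrr J^-1)%R; apply: cvgB => //; exact: cvg_cst.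
apply: (@squeeze_cvge _ _ _ _ (fun=> 0) _ _ _ _ (cvg_cst _) bound0).
near=> n; rewrite integral_ge0//=.
have In : (0 < I n)%R by near: n.
have Dn : \int[mu]_x `|g_ n x - g x|%:E = (D n)%:E by rewrite fineK//; near: n.
apply: (@le_trans _ _ (\int[mu]_x ((I n)^-1%:E * `|g_ n x - g x|%:E +
    `|(I n)^-1 - J^-1|%:E * (g x)%:E))).
  apply: ge0_le_integral => //=.
  - apply/measurable_EFinP; apply: measurableT_comp => //.
    by apply: measurable_funB; apply: measurable_funM.
  - apply: emeasurable_funD; first exact: measurable_funeM.
    by apply: measurable_funeM; exact/measurable_EFinP.
  - move=> x _; rewrite lee_fin -/(I n).
    rewrite (_ : _ - _ = (I n)^-1 * (g_ n x - g x) + ((I n)^-1 - J^-1) * g x)%R; last by ring.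
    by rewrite (le_trans (ler_normD _ _))// !normrM (ger0_norm (g0 x)) gtr0_norm// invr_gt0.
rewrite ge0_integralD//=.
- rewrite ge0_integralZl//=; last by rewrite lee_fin invr_ge0 ltW.
  rewrite ge0_integralZl//=; [|exact/measurable_EFinP|by move=> x _; rewrite lee_fin].
  by rewrite Dn gJ -!EFinM -EFinD lee_fin mulrC (mulrC J).
- by move=> x _; rewrite lee_fin mulr_ge0// invr_ge0 ltW.
- exact: measurable_funeM.
- by move=> x _; rewrite lee_fin mulr_ge0.
- by apply: measurable_funeM; exact/measurable_EFinP.
Unshelve. all: by end_near. Qed.

End L1_convergence.

(** * Laplace approximation *)

Section laplace_aux.
Context {R : realType}.

(* With e = expR (d n / (k + 1)), n ^ k / e ^ (k + 1) is at most a constant over n. *)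
Lemma cvg_exprn_expR (k : nat) (d : R) : 0 < d ->
  n%:R ^+ k * expR (- (n%:R * d)) @[n --> \oo] --> (0:R).
Proof.
move=> d0; pose e := d / k.+1%:R; have e0 : 0 < e by rewrite divr_gt0.
apply: (@cvg0_norm_le _ _ (fun n => (e ^+ k.+1)^-1 * (Num.sqrt n%:R)^-1 ^+ 2)); last first.
  rewrite [X in _ --> X](_ : 0 = (e ^+ k.+1)^-1 * 0 ^+ 2); last by rewrite expr0n mulr0.
  under eq_fun do rewrite expr2; rewrite expr2.
  by apply: cvgMr; apply: cvgM; exact: cvg_sqrtn_inv.
near=> n.
have n0 : (0 < n%:R :> R) by near: n; exact: nbhs_infty_gtr.
rewrite ger0_norm ?mulr_ge0 ?expR_ge0 ?exprn_ge0//.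
rewrite exprVn (sqr_sqrtr (ltW n0)) expRN -invfM.
have -> : expR (n%:R * d) = expR (n%:R * e) ^+ k.+1.
  rewrite -expRM_natl /e; congr expR; field.
  by rewrite addrC natr1.
rewrite ler_pdivrMr ?exprn_gt0 ?expR_gt0// mulrC ler_pdivlMr; last first.
  by rewrite mulr_gt0// exprn_gt0.
have ne0 : 0 <= n%:R * e by apply: mulr_ge0 => //; exact: ltW.
rewrite mulrCA -exprSr -exprMn mulrC lerXn2r ?nnegrE ?expR_ge0//.
by rewrite (le_trans _ (expR_ge1Dx _))// lerDr.
Unshelve. all: by end_near. Qed.

Lemma cvg_sqrtn_exprn_expR (k : nat) (d : R) : 0 < d ->
  Num.sqrt n%:R ^+ k * expR (- (n%:R * d)) @[n --> \oo] --> (0:R).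
Proof.
move=> d0; apply: cvg0_norm_le (cvg_exprn_expR k d0).
near=> n.
have n1 : (1 <= n%:R :> R) by near: n; exact: nbhs_infty_ger.
rewrite ger0_norm ?mulr_ge0 ?expR_ge0 ?exprn_ge0 ?sqrtr_ge0//.
rewrite ler_wpM2r ?expR_ge0// lerXn2r ?nnegrE ?sqrtr_ge0//.
rewrite -[leRHS]ger0_norm// -sqrtr_sqr ler_sqrt ?exprn_ge0//.
by rewrite expr2 ler_peMl// (le_trans ler01).
Unshelve. all: by end_near. Qed.

Context {D : nat}.

Lemma qform_scalar_mx (a : R) (x : 'rV[R]_D) : qform a%:M x = a * sumsq x.
Proof.
rewrite /qform mul_mx_scalar -scalemxAl mxE /sumsq mxE; congr (_ * _).
by apply: eq_bigr => i _; rewrite mxE expr2.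
Qed.

Lemma posdef_scalar_mx (a : R) : 0 < a -> posdefmx (a%:M : 'M[R]_D).
Proof.
move=> a0; split => [|x x0]; first by rewrite tr_scalar_mx.
rewrite -/(qform _ x) qform_scalar_mx mulr_gt0//.
by rewrite (lt_le_trans _ (norm2_le_sumsq x))// exprn_gt0// normr_gt0.
Qed.

Lemma integrable_gauss_sumsq (k c : R) : 0 <= k -> 0 < c ->
  (lebesgue_rV D).-integrable setT
    (EFin \o (fun x : 'rV[R]_D => k * expR (- (c * sumsq x)))).
Proof.
move=> k0 c0; have c2 : 0 < c *+ 2 by rewrite mulrn_wgt0.
have gE x : expR (- (c * sumsq x)) = expR (- qform ((c *+ 2)%:M : 'M[R]_D) x / 2).
  rewrite qform_scalar_mx; congr expR; rewrite -mulr_natr.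
  by move: (sumsq x) => s; field.
have mg : measurable_fun setT (fun x : 'rV[R]_D => k * expR (- (c * sumsq x))).
  under eq_fun do rewrite gE.
  by apply: measurable_funM => //; exact: measurable_gauss_rV.
apply/integrableP; split; first exact/measurable_EFinP.
under eq_integral => x _.
  rewrite /= ger0_norm ?mulr_ge0 ?expR_ge0// gE EFinM.
  over.
rewrite ge0_integralZl//=.
- rewrite (gaussian_integral_rV (posdef_scalar_mx c2)).2 -EFinM; exact: ltry.
- by apply/measurable_EFinP; exact: measurable_gauss_rV.
Qed.

Lemma measurable_cball (x : 'rV[R]_D) (r : R) : measurable (cball x r).
Proof.
rewrite -[cball x r]setCK; apply: measurableC; apply: open_measurable_rV.
by apply: closed_openC; apply: compact_closed; [exact: norm_hausdorff|exact: cball_compact].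
Qed.

Lemma measurable_eball (x : 'rV[R]_D) (r : R) : measurable (eball x r).
Proof.
have md : measurable_fun setT (fun y : 'rV[R]_D => enorm (y - x)).
  apply: (measurableT_comp (continuous_measurable_fun (@sqrt_continuous R))).
  apply: measurable_sum => i; apply: measurable_funX.
  under eq_fun do rewrite !mxE.
  by apply: measurable_funB => //; exact: measurable_coord.
have := md measurableT _ (measurable_itv `]-oo, r[); rewrite setTI.
by rewrite (_ : _ @^-1` _ = eball x r)//; apply/seteqP; split => y /=; rewrite in_itv.
Qed.

Lemma cball_sub_eball (x : 'rV[R]_D) (e : R) : 0 < e ->
  exists2 r : R, 0 < r & forall y, `|y - x| < r -> eball x e y.
Proof.
move=> e0; have D1 : 0 < D%:R + 1 :> R by rewrite ltr_wpDl.
(* [D + 1] exceeds the square root of [D], the comparison constant of the two norms, and stays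
   positive for [D = 0]. *)
exists (e / (D%:R + 1)); first by rewrite divr_gt0.
move=> y; rewrite ltr_pdivlMr// => yx; rewrite /eball/= /enorm.
rewrite (le_lt_trans _ yx)// -[leRHS]ger0_norm ?mulr_ge0 ?(ltW D1)// -sqrtr_sqr.
rewrite ler_sqrt ?sqr_ge0// -/(sumsq _) (le_trans (sumsq_le_norm2 _))// exprMn mulrC.
rewrite ler_wpM2l ?sqr_ge0// expr2 (@le_trans _ _ (D%:R + 1))// ?lerDl//.
by rewrite ler_peMl ?(ltW D1)// lerDr.
Qed.

End laplace_aux.

(** * Posterior weights around the minimizers and their Gaussian limit *)

Section laplace.
Context {R : realType} {D : nat}.
Variables (Theta : set 'rV[R]_D) (prior : 'rV[R]_D -> R)
  (f_ : nat -> 'rV[R]_D -> R) (x0 : 'rV[R]_D) (th : nat -> 'rV[R]_D).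

(** The unnormalized posterior with [exp (- n f_n (th n))] factored out, so that the exponent
    vanishes at [th n]. *)
Definition weight n x : R :=
  if x \in Theta then expR (- (n%:R * (f_ n x - f_ n (th n)))) * prior x else 0.

(** The Jacobian of the scaling is left out; this is the normalization with a nonzero finite
    limit. *)
Definition scaled_weight n x : R := weight n (th n + (Num.sqrt n%:R)^-1 *: x).

Local Notation "'mass' n" := (\int[lebesgue_rV D]_x (scaled_weight n x)%:E)%E (at level 10).

Hypothesis mTheta : measurable Theta.
Hypothesis mf_ : forall n, measurable_fun Theta (f_ n).
Hypothesis prior_density : prob_density_on Theta prior.

Let mprior : measurable_fun Theta prior := let: And3 m _ _ := prior_density in m.
Let prior_ge0 x : Theta x -> 0 <= prior x := let: And3 _ p _ := prior_density in p x.
Let prior_1 : (\int[lebesgue_rV D]_(x in Theta) (prior x)%:E = 1)%E :=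
  let: And3 _ _ i := prior_density in i.

Lemma measurable_fun_if_mem (g : 'rV[R]_D -> R) : measurable_fun Theta g ->
  measurable_fun setT (fun x => if x \in Theta then g x else 0).
Proof.
move=> mg; rewrite (_ : (fun x => _) = g \_ Theta); last first.
  by apply/funext => x; rewrite patchE.
exact/(measurable_restrictT _ mTheta).
Qed.

Lemma measurable_weight n : measurable_fun setT (weight n).
Proof.
apply: measurable_fun_if_mem; apply: measurable_funM => //.
apply: measurableT_comp => //; apply: measurableT_comp => //.
by apply: measurable_funM => //; exact: measurable_funB.
Qed.

Lemma weight_ge0 n x : 0 <= weight n x.
Proof.
rewrite /weight; case: ifPn => // /set_mem xT.
by rewrite mulr_ge0 ?expR_ge0// prior_ge0.
Qed.

Lemma measurable_scaled_weight n : measurable_fun setT (scaled_weight n).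
Proof. exact: (measurableT_comp (measurable_weight n) (measurable_affine_rV _ _)). Qed.

Lemma scaled_weight_ge0 n x : 0 <= scaled_weight n x.
Proof. exact: weight_ge0. Qed.

Lemma normalizerE n : normalizer Theta prior f_ n =
  ((expR (- (n%:R * f_ n (th n))))%:E * \int[lebesgue_rV D]_x (weight n x)%:E)%E.
Proof.
rewrite -ge0_integralZl//=.
- rewrite /normalizer integral_mkcond; apply: eq_integral => x _.
  rewrite patchE /weight; case: ifPn => _; last by rewrite mule0.
  rewrite -EFinM mulrA -expRD; congr ((expR _ * _)%:E).
  by move: (f_ n x) (f_ n (th n)) => a b; ring.
- by apply/measurable_EFinP; exact: measurable_weight.
- by move=> x _; rewrite lee_fin weight_ge0.
Qed.

Lemma posteriorE n x : posterior Theta prior f_ n x =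
  weight n x / fine (\int[lebesgue_rV D]_x (weight n x)%:E).
Proof.
rewrite /posterior normalizerE /weight; case: ifPn => _; last by rewrite mul0r.
set U := (\int[_]_x _)%E.
(* The identity survives an infinite integral, where [fine] is 0 on both sides. *)
have -> : fine ((expR (- (n%:R * f_ n (th n))))%:E * U) = expR (- (n%:R * f_ n (th n))) * fine U.
  case: U => [u| |] //=; rewrite mulr0.
    by rewrite gt0_muley ?lte_fin ?expR_gt0.
  by rewrite gt0_muleNy ?lte_fin ?expR_gt0.
have -> : expR (- (n%:R * (f_ n x - f_ n (th n)))) =
    expR (- (n%:R * f_ n x)) / expR (- (n%:R * f_ n (th n))).
  rewrite -expRN -expRD; congr expR.
  by move: (f_ n x) (f_ n (th n)) => a b; ring.
by rewrite invfM mulrA; congr (_ / _); rewrite mulrAC.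
Qed.

Lemma integral_weight n (F : 'rV[R]_D -> \bar R) : (0 < n)%N ->
  measurable_fun setT F -> (forall x, 0 <= F x)%E ->
  (\int[lebesgue_rV D]_x F x = ((Num.sqrt n%:R)^-1 ^+ D)%:E *
   \int[lebesgue_rV D]_x F (th n + (Num.sqrt n%:R)^-1 *: x)%R)%E.
Proof.
by move=> n0 mF F0; apply: ge0_integral_rV_affine => //; rewrite invr_gt0 sqrtr_gt0 ltr0n.
Qed.

(** The prior has total mass 1 on [Theta], so the bound does not involve the volume of [B]. *)
Lemma integral_weight_compl n (B : set 'rV[R]_D) (d : R) : measurable B ->
  (forall y, Theta y -> B y -> d <= f_ n y - f_ n (th n)) ->
  (\int[lebesgue_rV D]_(x in B) (weight n x)%:E <= (expR (- (n%:R * d)))%:E)%E.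
Proof.
move=> mB dB; rewrite integral_mkcond.
apply: (@le_trans _ _ (\int[lebesgue_rV D]_(x in Theta)
    ((expR (- (n%:R * d)))%:E * (prior x)%:E))%E).
  rewrite [leRHS]integral_mkcond; apply: ge0_le_integral => //=.
  - by move=> x _; rewrite patchE; case: ifPn => // _; rewrite lee_fin weight_ge0.
  - apply/(measurable_restrictT _ mB); apply: measurable_funTS.
    by apply/measurable_EFinP; exact: measurable_weight.
  - apply/(measurable_restrictT _ mTheta); apply: measurable_funeM.
    exact/measurable_EFinP.
  - move=> x _; rewrite !patchE /weight.
    case: (boolP (x \in Theta)) => [/set_mem xT|_]; last by case: ifPn.
    case: ifPn => [/set_mem xB|_]; last by rewrite lee_fin mulr_ge0 ?expR_ge0 ?prior_ge0.
    rewrite lee_fin ler_wpM2r ?prior_ge0// ler_expR lerN2 ler_wpM2l//; exact: dB.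
rewrite ge0_integralZl//=; first by rewrite prior_1 mule1.
- exact/measurable_EFinP.
Qed.

Variables (H : 'M[R]_D) (r c : R).
Hypothesis prior_cont : {for x0, continuous prior}.
Hypothesis prior_gt0 : 0 < prior x0.
Hypothesis posH : posdefmx H.
Hypothesis r0 : 0 < r.
Hypothesis c0 : 0 < c.
Hypothesis rTheta : cball x0 r `<=` Theta.
Hypothesis th_cvg : th n @[n --> \oo] --> x0.
Hypothesis f_lower : \forall n \near \oo, forall y, cball x0 r y ->
  c * sumsq (y - th n) <= f_ n y - f_ n (th n).
Hypothesis f_tail : forall eps : R, 0 < eps -> exists2 d : R, 0 < d &
  \forall n \near \oo, forall y, Theta y -> eps <= `|y - x0| ->
    d <= f_ n y - f_ n (th n).
Hypothesis f_quad : forall x : 'rV[R]_D,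
  n%:R * (f_ n (th n + (Num.sqrt n%:R)^-1 *: x) - f_ n (th n))
    @[n --> \oo] --> qform H x / 2.

Definition limit_weight x : R := prior x0 * expR (- qform H x / 2).

Let J : R := prior x0 * Num.sqrt ((2 * pi) ^+ D / \det H).

Let detH : 0 < \det H := (gaussian_integral_rV posH).1.

Let J0 : 0 < J.
Proof.
by rewrite mulr_gt0// sqrtr_gt0 divr_gt0// exprn_gt0// mulr_gt0// pi_gt0.
Qed.

Lemma measurable_limit_weight : measurable_fun setT limit_weight.
Proof. by apply: measurable_funM => //; exact: measurable_gauss_rV. Qed.

Lemma limit_weight_ge0 x : 0 <= limit_weight x.
Proof. by rewrite mulr_ge0 ?expR_ge0// ltW. Qed.

Lemma integral_limit_weight : (\int[lebesgue_rV D]_x (limit_weight x)%:E = J%:E)%E.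
Proof.
under eq_integral => x _ do rewrite EFinM.
rewrite ge0_integralZl//=.
- by rewrite (gaussian_integral_rV posH).2 -EFinM.
- by apply/measurable_EFinP; exact: measurable_gauss_rV.
- by rewrite lee_fin ltW.
Qed.

Lemma scaled_point_cvg (x : 'rV[R]_D) :
  th n + (Num.sqrt n%:R)^-1 *: x @[n --> \oo] --> x0.
Proof.
rewrite -[X in _ --> X]addr0; apply: cvgD; first exact: th_cvg.
rewrite [X in _ --> X](_ : 0 = (0 : R) *: x); last by rewrite scale0r.
by apply: cvgZr_tmp; exact: cvg_sqrtn_inv.
Qed.

Lemma near_cball (y : nat -> 'rV[R]_D) (e : R) : 0 < e ->
  y n @[n --> \oo] --> x0 -> \forall n \near \oo, cball x0 e (y n).
Proof.
move=> e0 /cvgrPdist_le/(_ _ e0); apply: filterS => n.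
by rewrite /cball/= distrC.
Qed.

Lemma scaled_weight_cvg (x : 'rV[R]_D) : scaled_weight n x @[n --> \oo] --> limit_weight x.
Proof.
have yx0 := scaled_point_cvg x.
have wE : \forall n \near \oo,
    expR (- (n%:R * (f_ n (th n + (Num.sqrt n%:R)^-1 *: x) - f_ n (th n)))) *
      prior (th n + (Num.sqrt n%:R)^-1 *: x) = scaled_weight n x.
  apply: filterS (near_cball r0 yx0) => n yr.
  by rewrite /scaled_weight /weight mem_set//; exact: rTheta.
apply: cvg_trans (near_eq_cvg wE) _.
rewrite /limit_weight mulrC; apply: cvgM; last exact: (cvg_comp _ _ yx0 prior_cont).
have -> : - qform H x / 2 = - (qform H x / 2) by rewrite mulNr.
apply: continuous_cvg; first exact: continuous_expR.
by apply: cvgN; exact: f_quad.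
Qed.

Let prior_bound : exists2 e : R, 0 < e & forall y, cball x0 e y -> prior y <= 2 * prior x0.
Proof.
have : \forall y \near x0, prior y < 2 * prior x0.
  by apply: (cvgr_lt _ prior_cont); rewrite mulr2n mulrDl mul1r ltrDl.
move=> /nbhs_ballP[e /= e0 eP]; exists (e / 2); first by rewrite divr_gt0.
move=> y ye; apply/ltW/eP; rewrite -ball_normE/= distrC (le_lt_trans ye)//.
by rewrite ltr_pdivrMr// ltr_pMr// ltr1n.
Qed.

(** While the unscaled point stays in a small ball, quadratic growth gives a fixed Gaussian
    envelope. Off that ball, the factor [sqrt n ^ D] from undoing the scaling is beaten by
    [exp (- n d)]. *)
Lemma scaled_weight_L1 :
  (\int[lebesgue_rV D]_x `|scaled_weight n x - limit_weight x|%:E @[n --> \oo] --> 0)%E.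
Proof.
have [e e0 eprior] := prior_bound.
(* Within [r] the quadratic lower bound holds; within [e] the prior is at most twice its value at
   [x0]. *)
pose q := Num.min r e; have q0 : 0 < q by rewrite lt_min r0.
have q_r y : cball x0 q y -> cball x0 r y.
  by move=> /le_trans; apply; rewrite ge_min lexx.
have q_e y : cball x0 q y -> cball x0 e y.
  by move=> /le_trans; apply; rewrite ge_min lexx orbT.
pose A n := (fun x => th n + (Num.sqrt (n%:R : R))^-1 *: x) @^-1` cball x0 q.
have mA n : measurable (A n).
  by rewrite -[A n]setTI; apply: measurable_affine_rV => //; exact: measurable_cball.
apply: (@cvg_L1_dominated_on _ _ R (lebesgue_rV D) _ _
    (fun x => 2 * prior x0 * expR (- (c * sumsq x))) A) => //.
- exact: measurable_scaled_weight.
- exact: measurable_limit_weight.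
- exact: scaled_weight_ge0.
- by apply: integrable_gauss_sumsq => //; rewrite mulr_ge0// ltW.
- near=> n => x xA.
  have n0 : (0 < n%:R :> R) by near: n; exact: nbhs_infty_gtr.
  have low : forall y, cball x0 r y -> c * sumsq (y - th n) <= f_ n y - f_ n (th n).
    by near: n.
  rewrite /scaled_weight /weight mem_set; last by apply/rTheta/q_r.
  rewrite mulrC ler_pM ?expR_ge0//; first by apply/prior_ge0/rTheta/q_r.
    exact/eprior/q_e.
  rewrite ler_expR lerN2; have := low _ (q_r _ xA).
  rewrite addrAC subrr add0r sumsqZ => /(ler_wpM2l (ltW n0)) L; apply: (le_trans _ L).
  (* The factor [n] cancels the squared scale, leaving an envelope independent of [n]. *)
  rewrite exprVn (sqr_sqrtr (ltW n0)) mulrCA mulVKf//.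
  exact: lt0r_neq0.
- by move=> x; rewrite mulr_ge0 ?expR_ge0// mulr_ge0// ltW.
- by move=> x; exact: near_cball q0 (scaled_point_cvg x).
- exact: scaled_weight_cvg.
have [d d0 dn] := f_tail q0.
apply: (@squeeze_cvge _ _ _ _ (fun=> 0%E) _
   (fun n => (Num.sqrt n%:R ^+ D * expR (- (n%:R * d)))%:E)).
- near=> n; rewrite integral_ge0/=; last by move=> x _; rewrite lee_fin scaled_weight_ge0.
  have n0 : (0 < n)%N by near: n; exact: nbhs_infty_gt.
  have sn0 : (0 < Num.sqrt n%:R ^+ D :> R) by rewrite exprn_gt0// sqrtr_gt0 ltr0n.
  have tail : forall y, Theta y -> q <= `|y - x0| -> d <= f_ n y - f_ n (th n) by near: n.
  have mB := measurableC (measurable_cball x0 q).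
  have -> : (\int[lebesgue_rV D]_(x in ~` A n) (scaled_weight n x)%:E =
     (Num.sqrt n%:R ^+ D)%:E * \int[lebesgue_rV D]_(x in ~` cball x0 q) (weight n x)%:E)%E.
    rewrite [X in (_ * X)%E]integral_mkcond (integral_weight n0).
    + rewrite muleA -EFinM -exprMn mulfV ?expr1n ?mul1e; last first.
        by rewrite gt_eqF// sqrtr_gt0 ltr0n.
      by rewrite integral_mkcond; apply: eq_integral => x _; rewrite !patchE !in_setC.
    + apply/(measurable_restrictT _ mB); apply: measurable_funTS.
      by apply/measurable_EFinP; exact: measurable_weight.
    + by move=> x; rewrite patchE; case: ifPn => // _; rewrite lee_fin weight_ge0.
  rewrite EFinM lee_pmul2l//; apply: integral_weight_compl => // y yT yq.
  by apply: tail => //; move/negP : yq; rewrite -ltNge => /ltW.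
- exact: cvg_cst.
- by apply: cvg_EFin; [exact: nearW|exact: cvg_sqrtn_exprn_expR].
Unshelve. all: by end_near. Qed.

Lemma mass_cvg : (mass n @[n --> \oo] --> J%:E)%E.
Proof.
exact: (cvg_integral_L1 measurable_scaled_weight measurable_limit_weight
  scaled_weight_ge0 limit_weight_ge0 integral_limit_weight scaled_weight_L1).
Qed.

Lemma weight_mass n : (0 < n)%N ->
  (\int[lebesgue_rV D]_x (weight n x)%:E = ((Num.sqrt n%:R)^-1 ^+ D)%:E * mass n)%E.
Proof.
move=> n0; apply: (integral_weight n0) => [|x]; last by rewrite lee_fin weight_ge0.
by apply/measurable_EFinP; exact: measurable_weight.
Qed.

(** Valid also when the mass is infinite, as both sides are then 0. *)
Lemma fine_weight_mass n : (0 < n)%N ->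
  fine (\int[lebesgue_rV D]_x (weight n x)%:E)%E = (Num.sqrt n%:R)^-1 ^+ D * fine (mass n).
Proof.
move=> n0; rewrite weight_mass//.
have s0 : 0 < (Num.sqrt n%:R)^-1 ^+ D :> R by rewrite exprn_gt0// invr_gt0 sqrtr_gt0 ltr0n.
case: (mass n) => [m| |] //=; rewrite mulr0.
  by rewrite gt0_muley ?lte_fin.
by rewrite gt0_muleNy ?lte_fin.
Qed.

Lemma near_mass : \forall n \near \oo, (mass n)%E \is a fin_num /\ 0 < fine (mass n).
Proof.
have /fine_cvgP[fin_mass cvg_mass] := mass_cvg.
by near=> n; split; near: n => //; exact: (cvgr_gt _ cvg_mass).
Unshelve. all: by end_near. Qed.

Lemma cvg_fine_mass : fine (mass n) @[n --> \oo] --> J.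
Proof. by have /fine_cvgP[] := mass_cvg. Qed.

Lemma posterior_ge0 n x : 0 <= posterior Theta prior f_ n x.
Proof.
rewrite posteriorE divr_ge0 ?weight_ge0// fine_ge0// integral_ge0// => y _.
by rewrite lee_fin weight_ge0.
Qed.

Lemma measurable_posterior n : measurable_fun setT (posterior Theta prior f_ n).
Proof.
rewrite (_ : posterior _ _ _ n = fun x => weight n x /
    fine (\int[lebesgue_rV D]_x (weight n x)%:E)%E); last first.
  by apply/funext => x; exact: posteriorE.
by apply: measurable_funM => //; exact: measurable_weight.
Qed.

(** The weight outside the ball is at most [exp (- n d)], while the total weight is [mass n] divided
    by [sqrt n ^ D], hence only polynomially small. *)
Lemma posterior_concentration (eps : R) : 0 < eps ->
  (\int[lebesgue_rV D]_(x in eball x0 eps) (posterior Theta prior f_ n x)%:E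
     @[n --> \oo] --> 1)%E.
Proof.
move=> eps0; have [q q0 q_eps] := cball_sub_eball x0 eps0.
have [d d0 dn] := f_tail q0.
have lower_cvg : (1 - Num.sqrt n%:R ^+ D * expR (- (n%:R * d)) * (fine (mass n))^-1)%:E
    @[n --> \oo] --> 1%E.
  apply: cvg_EFin; first exact: nearW.
  rewrite [X in _ --> X](_ : 1 = 1 - 0 * J^-1); last by rewrite mul0r subr0.
  apply: cvgB; first exact: cvg_cst.
  apply: cvgM; first exact: cvg_sqrtn_exprn_expR.
  by apply: cvgV; [exact: lt0r_neq0|exact: cvg_fine_mass].
apply: (squeeze_cvge _ lower_cvg (cvg_cst 1%E)).
near=> n.
have n0 : (0 < n)%N by near: n; exact: nbhs_infty_gt.
have sn0 : 0 < Num.sqrt n%:R ^+ D :> R by rewrite exprn_gt0// sqrtr_gt0 ltr0n.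
have [fin_m m0] : (mass n)%E \is a fin_num /\ 0 < fine (mass n) by near: n; exact: near_mass.
have tail : forall y, Theta y -> q <= `|y - x0| -> d <= f_ n y - f_ n (th n) by near: n.
have mB := measurable_eball x0 eps; have mCB := measurableC mB.
have mw : measurable_fun setT (fun x => (weight n x)%:E).
  by apply/measurable_EFinP; exact: measurable_weight.
have w_ge0 x : (0 <= (weight n x)%:E)%E by rewrite lee_fin weight_ge0.
pose w := fine (\int[lebesgue_rV D]_x (weight n x)%:E)%E.
have -> : (\int[lebesgue_rV D]_(x in eball x0 eps) (posterior Theta prior f_ n x)%:E =
    \int[lebesgue_rV D]_(x in eball x0 eps) (w^-1%:E * (weight n x)%:E))%E.
  by apply: eq_integral => x _; rewrite posteriorE mulrC EFinM.
have wE : w = (Num.sqrt n%:R)^-1 ^+ D * fine (mass n) by exact: fine_weight_mass.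
have w0 : 0 < w by rewrite wE mulr_gt0// exprn_gt0// invr_gt0 sqrtr_gt0 ltr0n.
have WE : (\int[lebesgue_rV D]_x (weight n x)%:E = w%:E)%E.
  by rewrite /w fineK// weight_mass// fin_numM.
rewrite ge0_integralZl//=; last 2 first.
- exact: measurable_funTS.
- by rewrite lee_fin invr_ge0 ltW.
have split_w : (w%:E = \int[lebesgue_rV D]_(x in eball x0 eps) (weight n x)%:E +
    \int[lebesgue_rV D]_(x in ~` eball x0 eps) (weight n x)%:E)%E.
  rewrite -WE -ge0_integral_setU ?setUv//.
  by apply/disj_setPS; rewrite setICr.
have tail_w : (\int[lebesgue_rV D]_(x in ~` eball x0 eps) (weight n x)%:E <=
    (expR (- (n%:R * d)))%:E)%E.
  apply: integral_weight_compl => // y yT yB; apply: tail => //.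
  by rewrite leNgt; apply/negP => /q_eps.
set b := (\int[lebesgue_rV D]_(x in eball x0 eps) _)%E in split_w *.
have b0 : (0 <= b)%E by apply: integral_ge0 => x _; exact: w_ge0.
have bw : (b <= w%:E)%E.
  by rewrite split_w leeDl// integral_ge0// => x _; exact: w_ge0.
have bfin : b \is a fin_num by rewrite ge0_fin_numE// (le_lt_trans bw)// ltry.
have wb : (w%:E <= b + (expR (- (n%:R * d)))%:E)%E by rewrite split_w leeD2l.
move: bw wb; rewrite -(fineK bfin) -EFinD -EFinM !lee_fin => bw wb.
apply/andP; split; last by rewrite mulrC ler_pdivrMr// mul1r.
have -> : Num.sqrt n%:R ^+ D * expR (- (n%:R * d)) / fine (mass n) = expR (- (n%:R * d)) / w.
  rewrite wE invfM exprVn invrK mulrAC mulrC.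
  by rewrite (mulrC (_ ^+ D)) mulrA.
by rewrite (mulrC w^-1) ler_pdivlMr// mulrBl mul1r divfK ?gt_eqF// lerBlDr.
Unshelve. all: by end_near. Qed.

(** For large [n] the ratio is exactly [mass n / J], and [mass n] tends to [J]. *)
Lemma normalizer_asymp : asymp_equiv (normalizer Theta prior f_) (fun n =>
  expR (- (n%:R * f_ n (th n))) * prior x0
    / Num.sqrt `|\det H| * (2 * pi / n%:R) `^ (D%:R / 2)).
Proof.
have ratio_cvg : (fine (mass n) / J)%:E @[n --> \oo] --> 1%E.
  apply: cvg_EFin; first exact: nearW.
  rewrite -[X in _ --> X](divff (lt0r_neq0 J0)).
  by apply: cvgMl; exact: cvg_fine_mass.
apply: cvg_trans ratio_cvg; apply: near_eq_cvg; near=> n.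
have n0 : (0 < n)%N by near: n; exact: nbhs_infty_gt.
have [fin_m m0] : (mass n)%E \is a fin_num /\ 0 < fine (mass n) by near: n; exact: near_mass.
have pi2 : 0 < 2 * pi :> R by rewrite mulr_gt0// pi_gt0.
have sn0 : 0 < Num.sqrt n%:R :> R by rewrite sqrtr_gt0 ltr0n.
have sd0 : 0 < Num.sqrt (\det H) by rewrite sqrtr_gt0.
have sp0 : 0 < Num.sqrt (2 * pi) :> R by rewrite sqrtr_gt0.
have e0 := expR_gt0 (- (n%:R * f_ n (th n))).
rewrite normalizerE weight_mass// -[X in (_ * (_ * X))%E]fineK// -!EFinM.
congr (_%:E).
have -> : (2 * pi / n%:R) `^ (D%:R / 2) = Num.sqrt (2 * pi) ^+ D * (Num.sqrt n%:R)^-1 ^+ D :> R.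
  rewrite (mulrC D%:R) powRrM powR12_sqrt ?divr_ge0 ?(ltW pi2)//.
  by rewrite powR_mulrn ?sqrtr_ge0// sqrtrM ?(ltW pi2)// sqrtrV// exprMn.
have -> : J = prior x0 * (Num.sqrt (2 * pi) ^+ D / Num.sqrt (\det H)).
  rewrite /J sqrtrM ?exprn_ge0 ?(ltW pi2)// sqrtrV ?(ltW detH)//.
  have -> : Num.sqrt ((2 * pi) ^+ D) = Num.sqrt (2 * pi) ^+ D :> R; last by [].
  rewrite -{1}(sqr_sqrtr (ltW pi2)) exprAC sqrtr_sqr ger0_norm//.
rewrite (ger0_norm (ltW detH)).
have := lt0r_neq0 e0; have := lt0r_neq0 sd0; have := lt0r_neq0 (prior_gt0).
have : Num.sqrt (2 * pi) ^+ D != 0 :> R by rewrite expf_neq0// lt0r_neq0.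
have : (Num.sqrt n%:R)^-1 ^+ D != 0 :> R by rewrite expf_neq0// invr_neq0// lt0r_neq0.
move: (fine _) (expR _) (Num.sqrt (\det H)) (prior x0) (_ ^+ D) (_ ^+ D).
move=> m e sd p a b b0 a0 p0 sd0' e0'.
by field; do !(apply/andP; split => //).
Unshelve. all: by end_near. Qed.

Definition rescaled_density n x : R :=
  (Num.sqrt n%:R)^-1 ^+ D * posterior Theta prior f_ n (th n + (Num.sqrt n%:R)^-1 *: x).

Local Notation rescaled_law n := (pushforward (with_density (posterior Theta prior f_ n))
  (fun y => Num.sqrt n%:R *: (y - th n))).

Lemma measurable_rescaled_density n : measurable_fun setT (rescaled_density n).
Proof.
apply: measurable_funM => //.
exact: (measurableT_comp (measurable_posterior n) (measurable_affine_rV _ _)).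
Qed.

Lemma rescaled_density_ge0 n x : 0 <= rescaled_density n x.
Proof. by rewrite mulr_ge0 ?posterior_ge0// exprn_ge0// invr_ge0 sqrtr_ge0. Qed.

(** Change of variables. At [n = 0] the scaling map is constant, hence the restriction to positive
    [n]. *)
Lemma rescaled_densityP n : (0 < n)%N -> is_density (rescaled_law n) (rescaled_density n).
Proof.
move=> n0; split; [exact: measurable_rescaled_density|exact: rescaled_density_ge0|].
move=> A mA; rewrite /pushforward /with_density.
have sn0 : 0 < Num.sqrt n%:R :> R by rewrite sqrtr_gt0 ltr0n.
set T := fun y => _; have mT : measurable (T @^-1` A).
  rewrite -[T @^-1` A]setTI.
  rewrite (_ : T = fun y => - (Num.sqrt n%:R *: th n) + Num.sqrt n%:R *: y).
    exact: measurable_affine_rV.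
  by apply/funext => y; rewrite /T scalerBr addrC.
have TK x : T (th n + (Num.sqrt n%:R)^-1 *: x) = x.
  by rewrite /T addrAC subrr add0r scalerA divff ?scale1r// lt0r_neq0.
rewrite integral_mkcond (integral_weight n0).
- rewrite -ge0_integralZl//=.
  + rewrite [RHS]integral_mkcond; apply: eq_integral => x _.
    rewrite !patchE /rescaled_density.
    have -> : (th n + (Num.sqrt n%:R)^-1 *: x \in T @^-1` A) = (x \in A).
      by apply/idP/idP => /set_mem; rewrite /preimage/= ?TK => xA; apply/mem_set; rewrite /= ?TK.
    by case: ifPn => _; rewrite ?mule0// EFinM.
  + apply: measurableT_comp (measurable_affine_rV _ _).
    apply/(measurable_restrictT _ mT); apply: measurable_funTS.
    by apply/measurable_EFinP; exact: measurable_posterior.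
  + by move=> x _; rewrite patchE; case: ifPn => // _; rewrite lee_fin posterior_ge0.
- apply/(measurable_restrictT _ mT); apply: measurable_funTS.
  by apply/measurable_EFinP; exact: measurable_posterior.
- by move=> x; rewrite patchE; case: ifPn => // _; rewrite lee_fin posterior_ge0.
Qed.

Lemma rescaled_densityE n x : (0 < n)%N ->
  rescaled_density n x = scaled_weight n x / fine (mass n).
Proof.
move=> n0; rewrite /rescaled_density posteriorE fine_weight_mass// invfM.
have s0 : (Num.sqrt n%:R)^-1 ^+ D != 0 :> R.
  by rewrite expf_neq0// invr_neq0// lt0r_neq0// sqrtr_gt0 ltr0n.
by rewrite mulrCA mulVKf// mulrC.
Qed.

Lemma mvnormal_pdfE x : mvnormal_pdf 0 (invmx H) x = limit_weight x / J.
Proof.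
rewrite /mvnormal_pdf subr0 invmxK det_inv /limit_weight -/(qform H x) /J.
by rewrite invfM [RHS]mulrACA mulfV ?lt0r_neq0// mul1r mulrC.
Qed.

(** Densities of one law agree almost everywhere, so any choice [q_ n] may be replaced by
    [rescaled_density n], a normalized scaled weight. *)
Lemma rescaled_law_cvg (q_ : nat -> 'rV[R]_D -> R) :
  (forall n, (0 < n)%N -> is_density (rescaled_law n) (q_ n)) ->
  (\int[lebesgue_rV D]_x `|q_ n x - mvnormal_pdf 0 (invmx H) x|%:E @[n --> \oo] --> 0)%E.
Proof.
move=> q_dens; have L1 := cvg_L1_normalized measurable_scaled_weight measurable_limit_weight
  scaled_weight_ge0 limit_weight_ge0 integral_limit_weight J0 scaled_weight_L1.
apply: cvg_trans L1; apply: near_eq_cvg; near=> n.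
have n0 : (0 < n)%N by near: n; exact: nbhs_infty_gt.
have [fin_m m0] : (mass n)%E \is a fin_num /\ 0 < fine (mass n) by near: n; exact: near_mass.
have [mq q0 qE] := q_dens n n0.
have [mp p0 pE] := rescaled_densityP n0.
(* Integrability is what allows equality of integrals over all measurable sets to give equality
   almost everywhere. *)
have int_p : (lebesgue_rV D).-integrable setT (EFin \o rescaled_density n).
  apply/integrableP; split; first exact/measurable_EFinP.
  rewrite (eq_integral (fun x => ((fine (mass n))^-1%:E * (scaled_weight n x)%:E)%E)).
    rewrite ge0_integralZl//=.
    - by rewrite -[X in (_ * X)%E]fineK// -EFinM ltry.
    - by apply/measurable_EFinP; exact: measurable_scaled_weight.
    - by move=> x _; rewrite lee_fin scaled_weight_ge0.
    - by rewrite lee_fin invr_ge0 ltW.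
  move=> x _ /=.
  by rewrite ger0_norm ?rescaled_density_ge0// rescaled_densityE// mulrC EFinM.
have pq : ae_eq (lebesgue_rV D) setT (EFin \o rescaled_density n) (EFin \o q_ n).
  apply: integral_ae_eq => //; first exact/measurable_EFinP.
  by move=> A _ mA; rewrite /= -/(with_density _ A) -/(with_density _ A) -pE// -qE.
have mN : measurable_fun setT (mvnormal_pdf 0 (invmx H)).
  rewrite (_ : mvnormal_pdf _ _ = fun x => limit_weight x / J); last first.
    by apply/funext => x; exact: mvnormal_pdfE.
  by apply: measurable_funM => //; exact: measurable_limit_weight.
rewrite (eq_integral (fun x => `|rescaled_density n x - mvnormal_pdf 0 (invmx H) x|%:E)).
  2: by move=> x _; rewrite rescaled_densityE// mvnormal_pdfE.
apply: ge0_ae_eq_integral => //.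
- by apply/measurable_EFinP; apply: measurableT_comp => //; exact: measurable_funB.
- by apply/measurable_EFinP; apply: measurableT_comp => //; exact: measurable_funB.
- by apply: filterS pq => x /(_ I)[->].
Unshelve. all: by end_near. Qed.

End laplace.

(** * Assembly of the asymptotic statements *)

Theorem theorem5 (R : realType) (D : nat) (Theta E : set 'rV[R]_D)
    (theta0 : 'rV[R]_D) (prior : 'rV[R]_D -> R)
    (f_ : nat -> 'rV[R]_D -> R) (f : 'rV[R]_D -> R)
    (mTheta : measurable Theta)
    (mf_ : forall n, measurable_fun Theta (f_ n))
    (E_Theta : E `<=` Theta) (E_open : open E) (E_bounded : bounded_set E)
    (E_theta0 : E theta0)
    (prior_density : prob_density_on Theta prior)
    (prior_continuous : {for theta0, continuous prior})
    (prior_gt0 : 0 < prior theta0)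
    (f_C3 : forall n, C3_on E (f_ n))
    (f_cvg : forall theta, Theta theta -> f_ n theta @[n --> \oo] --> f theta)
    (f_posdef : posdefmx (hessian f theta0))
    (f_bounded3 : exists M : R, forall n theta, E theta ->
       tensor_norm (third_deriv (f_ n) theta) <= M) :
  let cond1 := exists K : set 'rV[R]_D,
    [/\ compact K, K `<=` E, interior K theta0,
        forall theta, K theta -> theta != theta0 -> f theta0 < f theta &
        ((f theta0)%:E < limn_einf (fun n =>
           ereal_inf [set (f_ n theta)%:E | theta in Theta `\` K]))%E] in
  let cond2 := (forall n, convex_fun_on Theta (f_ n)) /\
               gradient f theta0 = 0 in
  let z_ := normalizer Theta prior f_ in
  let pi_ := posterior Theta prior f_ in
  let H0 := hessian f theta0 in
  (cond1 \/ cond2 ->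
   exists theta_ : nat -> 'rV[R]_D,
     [/\ forall n, Theta (theta_ n),
         theta_ n @[n --> \oo] --> theta0,
         \forall n \near \oo, gradient (f_ n) (theta_ n) = 0 &
         f_ n (theta_ n) @[n --> \oo] --> f theta0] /\
     [/\ forall eps : R, 0 < eps ->
           (\int[lebesgue_rV D]_(x in eball theta0 eps) (pi_ n x)%:E
              @[n --> \oo] --> 1)%E,
         asymp_equiv z_ (fun n =>
           expR (- (n%:R * f_ n (theta_ n))) * prior theta0
             / Num.sqrt `|\det H0| * (2 * pi / n%:R) `^ (D%:R / 2)) &
         let rescaled_law n := pushforward (with_density (pi_ n))
           (fun theta => Num.sqrt n%:R *: (theta - theta_ n)) in
         (exists q_ : nat -> 'rV[R]_D -> R,
            forall n, (0 < n)%N -> is_density (rescaled_law n) (q_ n)) /\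
         forall q_ : nat -> 'rV[R]_D -> R,
           (forall n, (0 < n)%N -> is_density (rescaled_law n) (q_ n)) ->
           (\int[lebesgue_rV D]_x
              `|q_ n x - mvnormal_pdf 0 (invmx H0) x|%:E
              @[n --> \oo] --> 0)%E]) /\
  (cond2 -> cond1).
Proof.
move=> cond1 cond2 z_ pi_ H0; have [M f_M] := f_bounded3.
have f_E x : E x -> f_ n x @[n --> \oo] --> f x by move=> /E_Theta; exact: f_cvg.
(* Proved first, so that both cases of the disjunction reduce to [cond1]. *)
have cond21 : cond2 -> cond1.
  by case=> cvx; exact: (convex_cond_liminf E_Theta E_open f_C3 f_M f_E E_theta0 f_posdef cvx).
split=> // cond12; have [K [cK KE K0 fK liminfK]] : cond1 by case: cond12.
have [th [r [c [[r0 c0 rE th_cvg fth_cvg] [thr grad_th f_lower f_tail f_quad]]]]] :=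
  minimizers E_open f_C3 f_M f_E E_theta0 f_posdef cK KE K0 fK liminfK.
have rT : cball theta0 r `<=` Theta by move=> x /rE/E_Theta.
exists th; split.
  by split => // n; exact/rT/thr.
split.
- move=> eps eps0; exact: (posterior_concentration mTheta mf_ prior_density prior_continuous
    prior_gt0 f_posdef r0 c0 rT th_cvg f_lower f_tail f_quad eps0).
- exact: (normalizer_asymp mTheta mf_ prior_density prior_continuous
    prior_gt0 f_posdef r0 c0 rT th_cvg f_lower f_tail f_quad).
- split.
    exists (rescaled_density Theta prior f_ th) => n n0.
    exact: (rescaled_densityP th mTheta mf_ prior_density n0).
  move=> q_; exact: (rescaled_law_cvg mTheta mf_ prior_density prior_continuous
    prior_gt0 f_posdef r0 c0 rT th_cvg f_lower f_tail f_quad).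
Qed.
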